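(* Let $n\in\{2,3\}$ and, for $r>0$, let $B(r)\subset\mathbb R^n$ denote the open ball of radius $r$ centred at the origin. Let $0<r_1<r_2<r_3$ and set \[ \alpha:=\frac{\log(r_3)-\log(r_2)}{\log(r_3)-\log(r_1)}\in(0,1). \] Then: (i) for every function $u$ harmonic in $B(r_3)$ (i.e. $\Delta u=0$ in $B(r_3)$) there holds \[ \|u\|_{L^2(B(r_2))}\le \|u\|_{L^2(B(r_1))}^{\alpha}\,\|u\|_{L^2(B(r_3))}^{1-\alpha}; \] (ii) the exponent $\alpha$ is optimal: there do not exist $\tilde\alpha>\alpha$ and a constant $C>0$ such that \[ \|u\|_{L^2(B(r_2))}\le C\,\|u\|_{L^2(B(r_1))}^{\tilde\alpha}\,\|u\|_{L^2(B(r_3))}^{1-\tilde\alpha} \] holds for all functions $u$ harmonic on $\mathbb R^n$.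
   Context: Equivalently $\alpha=\beta/(1+\beta)$ with $\beta=\frac{\log r_3-\log r_2}{\log r_2-\log r_1}$. Norms are standard $L^2$ norms on the indicated balls. *)

(* Defs.v *)
From HB Require Import structures.
From mathcomp Require Import all_boot all_order all_algebra.
From mathcomp Require Import all_classical all_reals all_analysis.
Set Implicit Arguments. Unset Strict Implicit. Unset Printing Implicit Defensive.
Import Order.TTheory GRing.Theory Num.Theory.
Import numFieldNormedType.Exports.
Local Open Scope classical_set_scope.
Local Open Scope ring_scope.

Definition eball {R : realType} (n : nat) (r : R) : set 'rV[R]_n :=
  [set x | \sum_(i < n) (x ord0 i) ^+ 2 < r ^+ 2].

(* Lebesgue integral over R^n of a function with values in \bar R, computed
   as the iterated one-dimensional Lebesgue integral (Tonelli), first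
   coordinate outermost.  On R^0 (a point) it is evaluation. *)
Fixpoint iint {R : realType} (n : nat) : ('rV[R]_n -> \bar R) -> \bar R :=
  match n return ('rV[R]_n -> \bar R) -> \bar R with
  | 0 => fun f => f 0
  | n'.+1 => fun f =>
      (\int[@lebesgue_measure R]_t iint (fun y : 'rV[R]_n' =>
           f (row_mx (t%:M : 'rV[R]_1) y)))%E
  end.

Definition L2ball {R : realType} (n : nat) (r : R) (u : 'rV[R]_n -> R) : \bar R :=
  poweR (@iint R n (fun x => ((\1_(@eball R n r) x) * (u x) ^+ 2)%:E)) (2^-1).

Definition partial {R : realType} (n : nat) (i : 'I_n) (u : 'rV[R]_n -> R)
  : 'rV[R]_n -> R := fun x => 'D_(delta_mx ord0 i) u x.

Definition laplacian {R : realType} (n : nat) (u : 'rV[R]_n -> R)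
  : 'rV[R]_n -> R := fun x => \sum_(i < n) partial i (partial i u) x.

Definition harmonic_on {R : realType} (n : nat) (A : set 'rV[R]_n)
  (u : 'rV[R]_n -> R) : Prop :=
  forall x, A x ->
    [/\ differentiable u x,
        (forall i, differentiable (partial i u) x),
        (forall i j, {for x, continuous (partial j (partial i u))})
      & laplacian u x = 0].

(* Main.v *)
Require Import Defs.
From HB Require Import structures.
From mathcomp Require Import all_boot all_order all_algebra.
From mathcomp Require Import all_classical all_reals all_analysis.
From mathcomp Require Import measurable_realfun ring lra.
Import Order.TTheory GRing.Theory Num.Theory.
Import numFieldNormedType.Exports.
Local Open Scope classical_set_scope.
Local Open Scope ring_scope.

(* Let G(s) be the integral over the unit ball B of u(sy)^2, so that the
   square of the L^2 norm on B(r) is r^n G(r). For u harmonic the integral of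
   u(sy) u(ty) over B depends on s and t only through st: with v(y) = u(ay),
   w(y) = u(by) and ab fixed, its derivative in a is 1/a times the integral of
   y . X, where X = w grad v - v grad w is divergence free, and y . X is the
   divergence of (|y|^2 - 1)/2 X, which vanishes on the boundary of B. By
   Cauchy-Schwarz, G(sqrt(st))^2 <= G(s) G(t), so G, being continuous, is a
   log-convex function of log r; this is the three ball inequality. Optimality
   is tested on the homogeneous functions Re (x_1 + i x_2)^k as k grows. *)

Set Implicit Arguments. Unset Strict Implicit. Unset Printing Implicit Defensive.

(** A function harmonic in B(r3) need not be square integrable there, and bounds on it and its
    derivatives are uniform only on smaller balls. Log-convexity is therefore proved for radii below
    r3, and the largest radius then increases to r3, using only monotonicity of the integrals; an
    infinite norm on B(r3) makes the inequality trivial. The factor r^n only adds n log r, affine in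
    log r. The weight (|y|^2 - 1)/2 reduces the divergence theorem to the fundamental theorem of
    calculus on chords parallel to an axis: its gradient is y and it vanishes at both ends of each
    chord. As the integral is iterated, vanishing along all chords of one direction gives vanishing
    over B. Homogeneous functions give equality at the exponent alpha, since log r2 = alpha log r1 +
    (1 - alpha) log r3; at a larger exponent the ratio of the two sides grows geometrically with k
    and exceeds any C. *)

Local Notation borel R n := (g_sigma_algebraType (@open 'rV[R]_n)).

(** * Lebesgue measure on row vectors *)

Section sigma_finite_product.
Context (R : realType) d1 d2 (T1 : measurableType d1) (T2 : measurableType d2).
Variable m1 : {sigma_finite_measure set T1 -> \bar R}.
Variable m2 : {sigma_finite_measure set T2 -> \bar R}.

(** Both exhaustions are nondecreasing, so a point of [F i] times [G j] lies in the single product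
    of index [i + j]. *)
Lemma sigma_finite_product : sigma_finite setT (m1 \x m2)%E.
Proof.
have /sigma_finiteP[F [TF ndF Foo]] := sigma_finiteT m1.
have /sigma_finiteP[G [TG ndG Goo]] := sigma_finiteT m2.
exists (fun k => F k `*` G k) => [|k].
  apply/seteqP; split=> // -[x y] _.
  have [i _ Fx] : (\bigcup_i F i) x by rewrite -TF.
  have [j _ Gy] : (\bigcup_i G i) y by rewrite -TG.
  exists (i + j)%N => //; split => /=.
    by move/subsetPset: (ndF _ _ (leq_addr j i)); exact.
  by move/subsetPset: (ndG _ _ (leq_addl i j)); exact.
have [mF Fy] := Foo k; have [mG Gy] := Goo k.
split; first exact: measurableX.
by rewrite product_measure1E// lte_mul_pinfty// ge0_fin_numE.
Qed.

(* [product_measure1] is canonically sigma-finite only for subprobabilities,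
   hence the alias. *)
Definition prod_measure : set (T1 * T2) -> \bar R := (m1 \x m2)%E.
HB.instance Definition _ := Measure.on prod_measure.
HB.instance Definition _ := Measure_isSigmaFinite.Build _ _ _ prod_measure
  sigma_finite_product.
End sigma_finite_product.

Section borel_rV.
Context {R : realType}.

Definition rat_box n (qk : 'rV[rat]_n * nat) : set 'rV[R]_n :=
  [set x | forall i, `|x ord0 i - ratr (qk.1 ord0 i)| < qk.2.+1%:R^-1].

(** Boxes with rational centre and radius 1/(k+1) form a countable base. Through this, a map into
    R^n is Borel as soon as its coordinates are measurable. *)
Lemma open_rat_box n (U : set 'rV[R]_n) : open U ->
  U = \bigcup_qk (if `[< rat_box qk `<=` U >] then rat_box qk else set0).
Proof.
move=> oU; apply/seteqP; split=> [x Ux|x [qk _]]; last first.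
  by case: ifPn => [/asboolP+|//]; exact.
have /nbhs_ballP[e /= e0 beU] : nbhs x U by move: oU; rewrite openE; exact.
have [k ke] : exists k : nat, k.+1%:R^-1 < e / 2.
  have e20 : 0 < e / 2 by rewrite divr_gt0.
  exists (Num.truncn (e / 2)^-1).
  by rewrite invf_plt ?posrE//; exact: Num.Theory.truncnS_gt.
have qP i : exists q : rat, `|x ord0 i - ratr q| < k.+1%:R^-1.
  have [|q] := @rat_in_itvoo R (x ord0 i - k.+1%:R^-1) (x ord0 i + k.+1%:R^-1).
    by rewrite ltrD2l -subr_gt0 opprK addr_gt0 ?invr_gt0.
  by rewrite in_itv/= => xq; exists q; rewrite ltr_distlC.
have /choice[q qx] := qP.
exists (\row_i q i, k) => //.
have bx : rat_box (\row_i q i, k) x by move=> i /=; rewrite mxE.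
case: ifPn => // /asboolP[] y /= by_; apply: beU; split=> // i j.
rewrite ord1 /ball/=.
have := by_ j; have := bx j; rewrite /= => h1 h2.
rewrite (splitr e).
rewrite (le_lt_trans (ler_distD (ratr ((\row_i q i) ord0 j)) _ _))//.
by rewrite ltrD// ?(lt_trans h1)// distrC (lt_trans h2).
Qed.

Lemma countable_rat_box n : countable [set: 'rV[rat]_n * nat].
Proof. exact: countableP. Qed.

Section into_borel.
Context d (T : measurableType d) n (X : T -> 'rV[R]_n).
Hypothesis mX : forall i, measurable_fun setT (fun t => X t ord0 i).

Lemma measurable_preimage_open (U : set 'rV[R]_n) :
  open U -> measurable (X @^-1` U).
Proof.
move=> /open_rat_box ->; rewrite preimage_bigcup.
apply: countable_bigcupT_measurable => [|qk]; first exact: countable_rat_box.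
case: ifP => _; last by rewrite preimage_set0.
rewrite (_ : _ @^-1` _ = \bigcap_(i in setT) ((fun t => X t ord0 i) @^-1`
    ball (ratr (qk.1 ord0 i) : R) (qk.2.+1%:R^-1))).
  apply: fin_bigcap_measurable => // i _.
  rewrite -[X in measurable X]setTI; apply: mX => //.
  by apply: open_measurable; apply: ball_open.
apply/seteqP; split=> t /= h i; first by move=> _; rewrite /ball/= distrC.
by have := h i Logic.I; rewrite /ball/= distrC.
Qed.

Lemma measurable_fun_borel : measurable_fun setT (X : T -> borel R n).
Proof.
apply: (@measurability _ _ T (borel R n) setT X (@open 'rV[R]_n)) => // _ [U oU <-].
by rewrite setTI; exact: measurable_preimage_open.
Qed.
End into_borel.

Lemma measurable_open n (A : set 'rV[R]_n) :
  open A -> measurable (A : set (borel R n)).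
Proof. exact: sub_sigma_algebra. Qed.

Lemma continuous_on_borel_measurable n (A : set 'rV[R]_n) (f : 'rV[R]_n -> R) :
  open A -> (forall x, A x -> {for x, continuous f}) ->
  measurable_fun (A : set (borel R n)) (f : borel R n -> R).
Proof.
move=> oA cf; 
apply: (@measurability _ _ (borel R n) _ A f _
  (RGenOpens.measurableE R)).
move=> _ [_ [a [b ->] <-]]; apply: measurable_open.
rewrite openE => x [Ax] /= fxab; apply: filterI.
  by move: oA; rewrite openE; exact.
apply: (cf x Ax); exact: (near_in_itvoo fxab).
Qed.

Lemma continuous_borel_measurable n (f : 'rV[R]_n -> R) :
  continuous f -> measurable_fun setT (f : borel R n -> R).
Proof.
move=> cf; apply: (@continuous_on_borel_measurable n setT f openT) => x _.
exact: cf.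
Qed.

Lemma measurable_coord n (i : 'I_n) :
  measurable_fun setT (fun x : borel R n => (x : 'rV[R]_n) ord0 i).
Proof.
by apply: (@continuous_borel_measurable n (fun x => x ord0 i)); exact: coord_continuous.
Qed.

Definition rVcons n (t : R) (y : 'rV[R]_n) : 'rV[R]_n.+1 :=
  row_mx (t%:M : 'rV[R]_1) y.

Lemma rVcons0 n t (y : 'rV[R]_n) : rVcons t y ord0 ord0 = t.
Proof.
have -> : ord0 = lshift n ord0 :> 'I_(1 + n) by exact/val_inj.
by rewrite (row_mxEl (t%:M : 'rV[R]_1)) mxE eqxx mulr1n.
Qed.

Lemma rVconsS n t (y : 'rV[R]_n) j : rVcons t y ord0 (lift ord0 j) = y ord0 j.
Proof.
have -> : lift ord0 j = rshift 1 j :> 'I_(1 + n) by exact/val_inj.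
by rewrite (row_mxEr (t%:M : 'rV[R]_1)).
Qed.

Lemma measurable_rVcons d (T : measurableType d) n (s : T -> R)
    (y : T -> 'rV[R]_n) :
  measurable_fun setT s -> (forall i, measurable_fun setT (fun t => y t ord0 i)) ->
  forall i, measurable_fun setT (fun t => rVcons (s t) (y t) ord0 i).
Proof.
move=> ms my i.
have [j ->|->] := unliftP ord0 i.
  by under eq_fun do rewrite rVconsS; exact: my.
by under eq_fun do rewrite rVcons0; exact: ms.
Qed.

Lemma iint_ge0 n (f : 'rV[R]_n -> \bar R) : (forall x, 0 <= f x)%E ->
  (0 <= iint f)%E.
Proof.
elim: n f => [|n IH] f f0 /=; first exact: f0.
by apply: integral_ge0 => t _; exact: IH.
Qed.

(* A sigma-finite model of Lebesgue measure on R^n: [T] is the iterated product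
   R * (R * ... unit) and [X] reads off the coordinates. *)
Lemma iint_model n : exists (d : measure_display) (T : measurableType d)
    (mu : {sigma_finite_measure set T -> \bar R}) (X : T -> 'rV[R]_n),
  (forall i, measurable_fun setT (fun t => X t ord0 i)) /\
  forall f : 'rV[R]_n -> \bar R, (forall x, 0 <= f x)%E ->
    measurable_fun setT (f : borel R n -> \bar R) ->
    iint f = (\int[mu]_t f (X t))%E.
Proof.
elim: n => [|n [d [T [mu [X [mX iX]]]]]].
  exists _, unit, (\d_tt : {sigma_finite_measure set unit -> \bar R}), (fun=> 0).
  split=> [[]//|f f0 mf /=].
  by rewrite integral_dirac//= diracT mul1e.
exists _, (measurableTypeR R * T)%type, (prod_measure (@lebesgue_measure R) mu),
  (fun p => rVcons p.1 (X p.2)); split.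
  apply: measurable_rVcons => [|i]; first exact: measurable_fst.
  exact: (measurableT_comp (mX i)).
move=> f f0 mf; rewrite [RHS]fubini_tonelli1//=; last first.
  apply: measurableT_comp mf _; apply: measurable_fun_borel.
  apply: measurable_rVcons => [|i]; first exact: measurable_fst.
  exact: (measurableT_comp (mX i)).
apply: eq_integral => t _; rewrite iX//.
apply: (measurableT_comp mf); apply: measurable_fun_borel.
by apply: measurable_rVcons => // i; exact: measurable_coord.
Qed.

End borel_rV.

(** * Iterated integrals: exchange of coordinates, dilations, the associated measure *)

Section iint_theory.
Context {R : realType}.
Local Notation leb := (@lebesgue_measure R).

Lemma measurable_rVcons_section n (f : 'rV[R]_n.+1 -> \bar R) (t : R) :
  measurable_fun setT (f : borel R n.+1 -> \bar R) ->
  measurable_fun setT ((fun y => f (rVcons t y)) : borel R n -> \bar R).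
Proof.
move=> mf; apply: (measurableT_comp mf); apply: measurable_fun_borel.
by apply: measurable_rVcons => // i; exact: measurable_coord.
Qed.

Lemma measurable_iint_section n (f : 'rV[R]_n.+1 -> \bar R) :
  (forall x, 0 <= f x)%E -> measurable_fun setT (f : borel R n.+1 -> \bar R) ->
  measurable_fun setT (fun t : R => iint (fun y => f (rVcons t y))).
Proof.
move=> f0 mf; have [d [T [mu [X [mX iX]]]]] := @iint_model R n.
have mg : measurable_fun setT
    (fun p : measurableTypeR R * T => f (rVcons p.1 (X p.2))).
  apply: (measurableT_comp mf); apply: measurable_fun_borel.
  apply: measurable_rVcons => [|i]; first exact: measurable_fst.
  exact: (measurableT_comp (mX i)).
have := measurable_fun_fubini_tonelli_F (m2 := mu) _ mg (fun=> f0 _).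
congr (measurable_fun _ _); apply/funext => t.
by rewrite iX//; exact: measurable_rVcons_section.
Qed.

Definition upd n (y : 'rV[R]_n) (i : 'I_n) (t : R) : 'rV[R]_n :=
  \row_j if j == i then t else y ord0 j.

Lemma upd_rVcons0 n s t (y : 'rV[R]_n) : upd (rVcons s y) ord0 t = rVcons t y.
Proof.
apply/rowP => j; rewrite mxE; have [k ->|->] := unliftP ord0 j.
  by rewrite !rVconsS.
by rewrite eqxx rVcons0.
Qed.

Lemma upd_rVconsS n s t (y : 'rV[R]_n) i :
  upd (rVcons s y) (lift ord0 i) t = rVcons s (upd y i t).
Proof.
apply/rowP => j; rewrite mxE; have [k ->|->] := unliftP ord0 j.
  by rewrite !rVconsS mxE (inj_eq (lift_inj (h:=ord0))).
by rewrite (negbTE (neq_lift _ _)) !rVcons0.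
Qed.

(** By Tonelli the coordinate [i] may be integrated innermost, so agreement of the integrals along
    all lines of direction [i] suffices. *)
Lemma iint_eq_lines n (i : 'I_n) (f g : 'rV[R]_n -> \bar R) :
  (forall x, 0 <= f x)%E -> (forall x, 0 <= g x)%E ->
  measurable_fun setT (f : borel R n -> \bar R) ->
  measurable_fun setT (g : borel R n -> \bar R) ->
  (forall y, \int[leb]_t f (upd y i t) = \int[leb]_t g (upd y i t))%E ->
  iint f = iint g.
Proof.
elim: n i f g => [[]//|n IH] i f g f0 g0 mf mg fg.
have [j ij|i0] := unliftP ord0 i.
  apply: eq_integral => t _ /=; apply: (IH j) => //.
  - exact: (@measurable_rVcons_section n f).
  - exact: (@measurable_rVcons_section n g).
  move=> y; have := fg (rVcons t y); rewrite ij.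
  by under eq_integral do rewrite upd_rVconsS;
    under [in RHS]eq_integral do rewrite upd_rVconsS.
have [d [T [mu [X [mX iX]]]]] := @iint_model R n.
(* Here [i] is the outermost coordinate and is moved inside. The entry [0] is a placeholder that
   [upd] overwrites. *)
have swap h : (forall x, 0 <= h x)%E ->
    measurable_fun setT (h : borel R n.+1 -> \bar R) ->
    iint h = (\int[mu]_y \int[leb]_t h (upd (rVcons 0 (X y)) i t))%E.
  move=> h0 mh.
  transitivity (\int[leb]_t \int[mu]_y h (rVcons t (X y)))%E.
    apply: eq_integral => t _; apply: (iX (fun y => h (rVcons t y))) => //.
    exact: measurable_rVcons_section.
  have mp : measurable_fun setT
      (fun p : measurableTypeR R * T => h (rVcons p.1 (X p.2))).
    apply: (measurableT_comp mh); apply: measurable_fun_borel.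
    apply: measurable_rVcons => [|k]; first exact: measurable_fst.
    exact: (measurableT_comp (mX k)).
  rewrite (@fubini_tonelli _ _ _ _ _ leb mu _ mp)//.
  by apply: eq_integral => y _; apply: eq_integral => t _ /=; rewrite i0 upd_rVcons0.
by rewrite !swap//; apply: eq_integral => y _; exact: fg.
Qed.

(** The image of Lebesgue measure under multiplication by [r], scaled by [r], agrees with Lebesgue
    measure on half-open intervals, hence everywhere. *)
Lemma integral_dilation (K : R -> \bar R) (r : R) : 0 < r ->
  measurable_fun setT K -> (forall t, 0 <= K t)%E ->
  (\int[leb]_t K t = r%:E * \int[leb]_t K (r * t)%R)%E.
Proof.
move=> r0 mK K0.
have mr := @mulrl_measurable R setT r.
pose m0 : {measure set (measurableTypeR R) -> \bar R} :=
  pushforward leb ( *%R r : measurableTypeR R -> measurableTypeR R).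
pose m := m0 mr.
pose rn : {nonneg R} := NngNum (ltW r0).
transitivity (\int[mscale rn m]_t K t)%E; last first.
  rewrite ge0_integral_mscale//; congr (_ * _)%E.
  by rewrite /m ge0_integral_pushforward.
apply: eq_measure_integral => A mA _; apply: lebesgue_measure_unique => //.
move=> _ [[a b] _ <-] /=.
rewrite /mscale/= /m /m0/= /pushforward.
rewrite (_ : _ @^-1` _ = `]r^-1 * a, r^-1 * b]%classic); last first.
  apply/seteqP; split => t /=; rewrite !in_itv/=.
    by rewrite ltr_pdivrMl// ler_pdivlMl.
  by rewrite ltr_pdivrMl// ler_pdivlMl.
rewrite !lebesgue_measure_itv/= !lte_fin ltr_pM2l ?invr_gt0//.
case: ifPn => _; last by rewrite mule0.
by rewrite -!EFinB -EFinM -mulrBr mulVKf ?gt_eqF.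
Qed.

Lemma iint_dilation n (f : 'rV[R]_n -> \bar R) (r : R) : 0 < r ->
  (forall x, 0 <= f x)%E -> measurable_fun setT (f : borel R n -> \bar R) ->
  (iint f = (r ^+ n)%:E * iint (fun x => f (r *: x)))%E.
Proof.
move=> r0; elim: n f => [|n IH] f f0 mf.
  by rewrite /= scaler0 mul1e.
have rE t (y : 'rV[R]_n) : r *: rVcons t y = rVcons (r * t) (r *: y).
  apply/rowP => j; rewrite mxE; have [k ->|->] := unliftP ord0 j.
    by rewrite !rVconsS mxE.
  by rewrite !rVcons0.
pose K t := iint (fun y => f (rVcons t y)).
have mK : measurable_fun setT K by exact: measurable_iint_section.
have K0 t : (0 <= K t)%E by exact: iint_ge0.
have KE t : K t = ((r ^+ n)%:E * iint (fun y => f (rVcons t (r *: y))))%E.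
  by rewrite /K (IH (fun y => f (rVcons t y)))//; exact: measurable_rVcons_section.
have rn0 : (0 <= r ^+ n) by rewrite exprn_ge0// ltW.
transitivity (\int[leb]_t K t)%E; first by [].
rewrite (integral_dilation r0)// exprS EFinM -muleA; congr (_ * _)%E.
transitivity (\int[leb]_t ((r ^+ n)%:E * iint (fun y => f (r *: rVcons t y))))%E.
  apply: eq_integral => t _; rewrite KE; congr (_ * iint _)%E.
  by apply/funext => y; rewrite rE.
rewrite ge0_integralZl//.
- apply: (@measurable_iint_section n (fun x => f (r *: x))) => //.
  apply: (measurableT_comp mf); apply: measurable_fun_borel => i.
  under eq_fun do rewrite mxE.
  by apply: measurable_funM => //; exact: measurable_coord.
- by move=> t _; exact: iint_ge0.
Qed.

(** The image under [X] of the model measure. It places the iterated integral on R^n itself, where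
    integrability, domination and differentiation under the integral sign can be used. *)
Lemma iint_measure n : exists nu : {measure set (borel R n) -> \bar R},
  forall f : 'rV[R]_n -> \bar R, (forall x, 0 <= f x)%E ->
    measurable_fun setT (f : borel R n -> \bar R) ->
    iint f = (\int[nu]_x f x)%E.
Proof.
have [d [T [mu [X [mX iX]]]]] := @iint_model R n.
have mXb := measurable_fun_borel mX.
pose nu : {measure set (borel R n) -> \bar R} :=
  pushforward mu (X : T -> borel R n).
exists (nu mXb) => f f0 mf.
by rewrite ge0_integral_pushforward//= iX.
Qed.
End iint_theory.

(** * Balls *)

Section balls.
Context {R : realType}.

Lemma continuous_bigsum (T : topologicalType) (I : Type) (r : seq I)
    (F : I -> T -> R) (x : T) : (forall i, {for x, continuous (F i)}) ->
  {for x, continuous (fun y => \sum_(i <- r) F i y)}.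
Proof.
move=> cF; elim: r => [|i r IH].
  rewrite (_ : (fun _ => _) = cst 0); first exact: cvg_cst.
  by apply/funext => y; rewrite big_nil.
rewrite (_ : (fun _ => _) = F i + fun y => \sum_(i <- r) F i y).
  by apply: continuousD; [exact: cF|exact: IH].
by apply/funext => y; rewrite big_cons.
Qed.

(** The norm carried by row vectors is the sup norm; the Euclidean one enters only through its
    square. *)
Definition sqn n (x : 'rV[R]_n) : R := \sum_(i < n) x ord0 i ^+ 2.

Lemma sqnZ n c (x : 'rV[R]_n) : sqn (c *: x) = c ^+ 2 * sqn x.
Proof.
by rewrite /sqn mulr_sumr; apply: eq_bigr => i _; rewrite mxE exprMn.
Qed.

Lemma sqr_coord_le_sqn n (x : 'rV[R]_n) i : x ord0 i ^+ 2 <= sqn x.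
Proof.
by rewrite /sqn (bigD1 i)//= lerDl sumr_ge0// => j _; exact: sqr_ge0.
Qed.

Lemma coord_norm_le n (x : 'rV[R]_n) i (r : R) :
  0 <= r -> sqn x <= r ^+ 2 -> `|x ord0 i| <= r.
Proof.
move=> r0 xr; rewrite -(@ler_pXn2r _ 2)// ?nnegrE// real_normK ?num_real//.
exact: le_trans (sqr_coord_le_sqn _ _) xr.
Qed.

Lemma continuous_sqn n : continuous (@sqn n).
Proof.
move=> x; apply: continuous_bigsum => i.
by apply: continuousM; exact: coord_continuous.
Qed.

Lemma open_eball n (r : R) : open (@eball R n r).
Proof.
rewrite (_ : eball _ = @sqn n @^-1` [set z | z < r ^+ 2]) //.
by apply: open_comp => [x _|]; [exact: continuous_sqn|exact: open_lt].
Qed.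

Lemma compact_sqn_le n (r : R) :
  0 <= r -> compact [set x : 'rV[R]_n | sqn x <= r ^+ 2].
Proof.
move=> r0; apply: bounded_closed_compact.
  exists r; split=> [|M rM x /= xr]; first exact: num_real.
  rewrite [leLHS]mx_normrE; apply/bigmax_leP; split=> [|[i j] _ /=].
    exact: le_trans r0 (ltW rM).
  by rewrite ord1; apply: le_trans (ltW rM); exact: coord_norm_le.
rewrite (_ : mkset _ = @sqn n @^-1` [set z | z <= r ^+ 2]) //.
by apply: preimage_closed => [x _|]; [exact: continuous_sqn|exact: closed_le].
Qed.

Lemma continuous_bounded_on n (f : 'rV[R]_n -> R) (K : set 'rV[R]_n) :
  compact K -> (forall x, K x -> {for x, continuous f}) ->
  exists2 M : R, 0 < M & forall x, K x -> `|f x| <= M.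
Proof.
move=> cK cf.
have /compact_bounded[M [_ Mf]] : compact (f @` K).
  apply: continuous_compact cK; apply: continuous_in_subspaceT => x /set_mem.
  exact: cf.
exists (`|M| + 1); first by rewrite ltr_wpDl.
move=> x Kx; apply: Mf; last by exists x.
by rewrite (le_lt_trans (ler_norm _))// ltrDl.
Qed.

Definition box n (a : 'rV[R]_n) (e : R) : set 'rV[R]_n :=
  [set x | forall i, `|a ord0 i - x ord0 i| < e].

Lemma open_box n (a : 'rV[R]_n) e : 0 < e -> open (box a e).
Proof.
move=> e0; rewrite (_ : box a e = ball a e); first exact: ball_open.
apply/seteqP; split=> x; first by move=> h; split=> // i j; rewrite ord1; exact: h.
by move=> [_ h] i; exact: h.
Qed.

Lemma iint0 n : iint (fun _ : 'rV[R]_n => 0%E) = 0%E.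
Proof.
elim: n => [//|n IH] /=; under eq_integral do rewrite IH.
exact: integral0.
Qed.

(** Volume of a sup-norm ball: it bounds the volume of the unit ball from above, and later bounds an
    integral from below. *)
Lemma iint_box n (a : 'rV[R]_n) e : 0 < e ->
  iint (fun x => (\1_(box a e) x)%:E) = ((2 * e) ^+ n)%:E.
Proof.
move=> e0; elim: n a => [|n IH] a.
  by rewrite /= expr0 indicE mem_set// => -[].
pose a' : 'rV[R]_n := \row_j a ord0 (lift ord0 j).
have boxE t y : box a e (rVcons t y) <-> `|a ord0 ord0 - t| < e /\ box a' e y.
  split=> [h|[h1 h2] i].
    split; first by have := h ord0; rewrite rVcons0.
    by move=> j; have := h (lift ord0 j); rewrite rVconsS mxE.
  have [j ->|->] := unliftP ord0 i; last by rewrite rVcons0.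
  by rewrite rVconsS; have := h2 j; rewrite mxE.
transitivity (\int[@lebesgue_measure R]_t
    (((2 * e) ^+ n)%:E * (\1_(ball (a ord0 ord0 : R) e) t)%:E))%E.
  apply: eq_integral => t _ /=; rewrite [X in _ = (_ * X%:E)%E]indicE.
  have [/set_mem te|/negP te] := boolP (t \in _).
    rewrite mule1 -(IH a'); congr iint; apply/funext => y; congr EFin.
    rewrite !indicE; congr (nat_of_bool _)%:R.
    by apply/idP/idP => /set_mem h; apply/mem_set; [have [] := (boxE t y).1 h|apply/boxE].
  rewrite mule0 -[RHS](iint0 n); congr iint; apply/funext => y; congr EFin.
  rewrite indicE memNset// => /boxE[h _]; apply: te; exact/mem_set.
rewrite ge0_integralZl//; last 2 first.
- by apply/measurable_EFinP; apply: measurable_indic; apply: open_measurable; exact: ball_open.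
- by rewrite lee_fin exprn_ge0// mulr_ge0// ltW.
rewrite integral_indic//; last by apply: open_measurable; exact: ball_open.
rewrite setIT /= lebesgue_measure_ball; last exact: ltW.
by rewrite -EFinM exprSr mulr_natl.
Qed.
End balls.

(** * Integration over the unit ball *)

Section unit_ball_integral.
Context {R : realType} (n : nat).
Variable nu : {measure set (borel R n) -> \bar R}.
Hypothesis iint_nu : forall f : 'rV[R]_n -> \bar R, (forall x, 0 <= f x)%E ->
  measurable_fun setT (f : borel R n -> \bar R) -> iint f = (\int[nu]_x f x)%E.
Local Notation leb := (@lebesgue_measure R).
Local Notation B := (@eball R n 1 : set (borel R n)).

Lemma iint_indic (A : set 'rV[R]_n) : open A ->
  iint (fun x => (\1_A x)%:E) = nu A.
Proof.
move=> oA; have mA := measurable_open oA.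
rewrite iint_nu//; first by rewrite integral_indic// setIT.
by apply/measurable_EFinP; exact: measurable_indic.
Qed.

Lemma measure_box (a : 'rV[R]_n) (e : R) : 0 < e ->
  nu (box a e) = ((2 * e) ^+ n)%:E.
Proof. by move=> e0; rewrite -(iint_box a)// iint_indic//; exact: open_box. Qed.

Lemma measurable_unit_ball : measurable B.
Proof. by apply: measurable_open; exact: open_eball. Qed.

Lemma measure_unit_ball_fin : (nu B < +oo)%E.
Proof.
apply: (@le_lt_trans _ _ (nu (box 0 1))); last by rewrite measure_box// ltry.
apply: le_measure; rewrite ?inE.
- exact: measurable_unit_ball.
- by apply: measurable_open; exact: open_box.
move=> x xB i; rewrite mxE sub0r normrN.
rewrite -(@ltr_pXn2r _ 2)// ?nnegrE// real_normK ?num_real//.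
exact: le_lt_trans (sqr_coord_le_sqn _ _) xB.
Qed.

(** Continuity is required on the closed ball, whose compactness bounds [f]; the open ball has
    finite measure. *)
Lemma integrable_unit_ball (f : 'rV[R]_n -> R) :
  (forall x, sqn x <= 1 -> {for x, continuous f}) ->
  nu.-integrable B (EFin \o f).
Proof.
move=> cf.
apply: measurable_bounded_integrable; first exact: measurable_unit_ball.
- exact: measure_unit_ball_fin.
- apply: continuous_on_borel_measurable; first exact: open_eball.
  by move=> x; rewrite /eball/= expr1n => /ltW; exact: cf.
have [|M M0 fM] := @continuous_bounded_on R n f _ (compact_sqn_le ler01).
  by move=> x /=; rewrite expr1n; exact: cf.
exists M; split=> [|M' MM' x xB]; first exact: num_real.
by apply: le_trans (ltW MM'); apply: fM; exact: ltW xB.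
Qed.

(** The iterated integral is identified with [nu] for nonnegative functions, so [h], extended by
    zero, is split into positive and negative parts. On each line their integrals are finite with
    difference zero, hence equal, and [iint_eq_lines] applies. *)
Lemma integral_zero_lines (i : 'I_n) (h : 'rV[R]_n -> R) :
  nu.-integrable B (EFin \o h) ->
  (forall y, let S := [set t | eball 1 (upd y i t)] in
    [/\ measurable S, leb.-integrable S (fun t => (h (upd y i t))%:E) &
        \int[leb]_(t in S) (h (upd y i t))%:E = 0]%E) ->
  (\int[nu]_(y in B) (h y)%:E = 0)%E.
Proof.
move=> ih hl; have mB := measurable_unit_ball.
pose H := (EFin \o h) \_ B.
have mH : measurable_fun setT (H : borel R n -> \bar R).
  by apply/(measurable_restrictT _ mB); exact: measurable_int ih.
have iH : nu.-integrable setT (H : borel R n -> \bar R).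
  exact/(integrable_mkcond _ mB).
have HE : iint (H^\+)%E = iint (H^\-)%E.
  apply: (@iint_eq_lines R n i).
  - by move=> x; exact: funepos_ge0.
  - by move=> x; exact: funeneg_ge0.
  - exact: measurable_funepos.
  - exact: measurable_funeneg.
  move=> y; have [mS iS S0] := hl y.
  pose k := (fun t => (h (upd y i t))%:E) \_ [set t | eball 1 (upd y i t)].
  have Hk t : H (upd y i t) = k t.
    by rewrite /H /k !patchE; congr (if _ then _ else _);
      apply/idP/idP => /set_mem ?; exact/mem_set.
  have ik : leb.-integrable setT k.
    by exact: ((@integrable_mkcond _ _ R leb _
      (fun t => (h (upd y i t))%:E) mS).1 iS).
  have kp := integrable_pos_fin_num measurableT ik.
  have kn := integrable_neg_fin_num measurableT ik.
  transitivity (\int[leb]_t (k^\+ t))%E.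
    by apply: eq_integral => t _; rewrite !funeposE Hk.
  transitivity (\int[leb]_t (k^\- t))%E; last first.
    by apply: eq_integral => t _; rewrite !funenegE Hk.
  move: S0; rewrite integral_mkcond integralE => /eqP.
  by rewrite sube_eq// ?fin_num_adde_defl// ?add0e => /eqP.
rewrite integral_mkcond integralE.
rewrite -iint_nu; last 2 first.
- by move=> x; exact: funepos_ge0.
- exact: measurable_funepos.
rewrite -iint_nu; last 2 first.
- by move=> x; exact: funeneg_ge0.
- exact: measurable_funeneg.
rewrite HE subee// iint_nu.
- exact: integrable_neg_fin_num iH.
- by move=> x; exact: funeneg_ge0.
- exact: measurable_funeneg.
Qed.

Lemma measurable_indic_sqr (A : set 'rV[R]_n) (u : 'rV[R]_n -> R) : open A ->
  (forall x, A x -> {for x, continuous u}) ->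
  measurable_fun setT
    ((fun x => (\1_A x * u x ^+ 2)%:E) : borel R n -> \bar R).
Proof.
move=> oA cu; have mA := measurable_open oA; apply/measurable_EFinP.
rewrite (_ : (fun x => _) = ((fun x => u x ^+ 2) \_ A)).
  apply/(measurable_restrictT _ mA); apply: continuous_on_borel_measurable => //.
  by move=> x xr; apply: continuousM; exact: cu.
by rewrite patch_indic; apply/funext => x /=; rewrite mulrC.
Qed.

(* [r ^+ n] is the Jacobian of the dilation mapping [B] onto the ball of
   radius [r]. *)
Lemma iint_ball_dilation (r : R) (u : 'rV[R]_n -> R) : 0 < r ->
  (forall x, eball r x -> {for x, continuous u}) ->
  iint (fun x => (\1_(eball r) x * u x ^+ 2)%:E) =
  ((r ^+ n)%:E * \int[nu]_(y in B) (u (r *: y) ^+ 2)%:E)%E.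
Proof.
move=> r0 cu; have mB := measurable_unit_ball.
pose f : 'rV[R]_n -> \bar R := fun x => (\1_(eball r) x * u x ^+ 2)%:E.
have f0 x : (0 <= f x)%E by rewrite lee_fin mulr_ge0// sqr_ge0.
have mf : measurable_fun setT (f : borel R n -> \bar R).
  by apply: measurable_indic_sqr => //; exact: open_eball.
rewrite (iint_dilation r0 f0 mf); congr (_ * _)%E.
rewrite iint_nu//; last first.
  apply: (measurableT_comp mf); apply: measurable_fun_borel => i.
  under eq_fun do rewrite mxE.
  by apply: measurable_funM => //; exact: measurable_coord.
rewrite [RHS]integral_mkcond; apply: eq_integral => y _.
rewrite patchE /f indicE.
have -> : (r *: y \in eball r) = (y \in B).
  apply/idP/idP => /set_mem; rewrite /eball/= => h; apply/mem_set;
    move: h; rewrite /eball/= -![\sum_(_ < _) _]/(sqn _) sqnZ expr1n.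
    by rewrite gtr_pMr// exprn_gt0.
  by rewrite gtr_pMr// exprn_gt0.
by case: ifP => _; rewrite ?mul1r// mul0r.
Qed.

End unit_ball_integral.

(** * Derivatives along curves *)

Section curves.
Context {R : realType} (n : nat).

Lemma is_derive_along (w : 'rV[R]_n -> R) (g : R -> 'rV[R]_n) (a : R) dg :
  is_derive a 1 g dg -> differentiable w (g a) ->
  is_derive a 1 (w \o g) ('d w (g a) dg).
Proof.
move=> gdg dw; have dga : differentiable g a by apply/derivable1_diffP.
have dwg : differentiable (w \o g) a by exact: differentiable_comp.
apply: DeriveDef; first exact/derivable1_diffP.
rewrite deriveE// diff_comp//=; congr ('d w _ _).
by rewrite -deriveE// derive_val.
Qed.

Lemma diff_partial (w : 'rV[R]_n -> R) x v : differentiable w x ->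
  'd w x v = \sum_(i < n) v ord0 i * partial i w x.
Proof.
move=> dw; rewrite {1}(row_sum_delta v) linear_sum; apply: eq_bigr => i _.
by rewrite linearZ /= /partial deriveE.
Qed.

Lemma is_derive_dilation (w : 'rV[R]_n -> R) (al : R -> R) (a dal : R) y :
  is_derive a 1 al dal -> differentiable w (al a *: y) ->
  is_derive a 1 (fun t => w (al t *: y))
    (dal * \sum_(i < n) y ord0 i * partial i w (al a *: y)).
Proof.
move=> ald dw.
have dg : is_derive a 1 (fun t => al t *: y) (dal *: y).
  have da : differentiable al a by apply/derivable1_diffP.
  have dg : differentiable ( *:%R ^~ y \o al) a.
    by apply: differentiable_comp => //; exact: ex_diff.
  change (is_derive a 1 ( *:%R ^~ y \o al) (dal *: y)).
  apply: DeriveDef; first exact/derivable1_diffP.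
  by rewrite deriveE// diff_comp//= diff_val/= -deriveE// derive_val.
apply: is_derive_eq (is_derive_along dg dw) _.
by rewrite linearZ /= diff_partial.
Qed.

Lemma updE (y : 'rV[R]_n) i t : upd y i t = upd y i 0 + t *: delta_mx ord0 i.
Proof.
apply/rowP => j; rewrite !mxE eqxx/=.
by case: eqP => _; rewrite ?mulr1 ?mulr0 ?add0r ?addr0.
Qed.

Lemma is_derive_upd (y : 'rV[R]_n) i (t c : R) :
  is_derive t 1 (fun s => c *: upd y i s) (c *: delta_mx ord0 i).
Proof.
have -> : (fun s => c *: upd y i s) =
    cst (c *: upd y i 0) + (fun s : R => s *: (c *: delta_mx ord0 i)).
  by apply/funext => s; rewrite updE scalerDr !fctE scalerA mulrC -scalerA.
have dl : is_derive t 1 (fun s : R => s *: (c *: (delta_mx ord0 i : 'rV[R]_n)))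
    (c *: delta_mx ord0 i).
  apply: DeriveDef; first exact/derivable1_diffP/ex_diff.
  by rewrite deriveE// diff_val scale1r.
exact: is_derive_eq (is_deriveD (is_derive_cst _ _ _) dl) (add0r _).
Qed.

Lemma is_derive_line (w : 'rV[R]_n -> R) (y : 'rV[R]_n) i (t c : R) :
  differentiable w (c *: upd y i t) ->
  is_derive t 1 (fun s => w (c *: upd y i s)) (c * partial i w (c *: upd y i t)).
Proof.
move=> dw; apply: is_derive_eq (is_derive_along (is_derive_upd y i t c) dw) _.
by rewrite linearZ /= /partial deriveE.
Qed.

Lemma sqn_upd (y : 'rV[R]_n) i t : sqn (upd y i t) = t ^+ 2 + sqn (upd y i 0).
Proof.
rewrite /sqn [LHS](bigD1 i)//= [in RHS](bigD1 i)//= !mxE eqxx expr0n/= add0r.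
by congr (_ + _); apply: eq_bigr => j /negPf ji; rewrite !mxE ji.
Qed.
End curves.

(** * Symmetry of the Euler operator *)

Section euler_symmetry.
Context {R : realType} (n : nat).
Variable nu : {measure set (borel R n) -> \bar R}.
Hypothesis iint_nu : forall f : 'rV[R]_n -> \bar R, (forall x, 0 <= f x)%E ->
  measurable_fun setT (f : borel R n -> \bar R) -> iint f = (\int[nu]_x f x)%E.
Local Notation leb := (@lebesgue_measure R).
Local Notation B := (@eball R n 1 : set (borel R n)).
Variables (r3 : R) (u : 'rV[R]_n -> R).
Hypothesis hu : harmonic_on (@eball R n r3) u.

Lemma eball_dilation (a : R) (y : 'rV[R]_n) : 0 <= a -> a < r3 -> sqn y <= 1 ->
  eball r3 (a *: y).
Proof.
move=> a0 ar y1; rewrite /eball/= -[\sum_(_ < _) _]/(sqn _) sqnZ.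
apply: (@le_lt_trans _ _ (a ^+ 2)); first by rewrite ler_piMr// sqr_ge0.
by rewrite ltr_pXn2r// ?nnegrE// (le_trans a0)// ltW.
Qed.

Lemma continuous_dilation (w : 'rV[R]_n -> R) (a : R) (y : 'rV[R]_n) :
  (forall x, eball r3 x -> {for x, continuous w}) ->
  0 <= a -> a < r3 -> sqn y <= 1 -> {for y, continuous (fun z : 'rV[R]_n => w (a *: z))}.
Proof.
move=> cw a0 ar y1; apply: (@continuous_comp 'rV[R]_n 'rV[R]_n R ( *:%R a) w y).
  exact: scaler_continuous.
by apply: cw; exact: eball_dilation.
Qed.

Lemma harmonic_continuous (x : 'rV[R]_n) : eball r3 x -> {for x, continuous u}.
Proof. by move=> /hu[du _ _ _]; exact: differentiable_continuous. Qed.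

Lemma harmonic_partial_continuous i (x : 'rV[R]_n) :
  eball r3 x -> {for x, continuous (partial i u)}.
Proof. by move=> /hu[_ du _ _]; exact: differentiable_continuous. Qed.

Lemma harmonic_partial2_continuous i (x : 'rV[R]_n) :
  eball r3 x -> {for x, continuous (partial i (partial i u))}.
Proof. by move=> /hu[_ _ + _]; exact. Qed.

Variables (a b : R).
Hypotheses (a0 : 0 <= a) (ar : a < r3) (b0 : 0 <= b) (br : b < r3).

(* With v(y) = u(ay) and w(y) = u(by), [flux i] is the i-th component of
   X = w grad v - v grad w, which is divergence free, and [dflux i] is
   the i-th partial derivative of (|y|^2 - 1) / 2 times it. *)
Definition flux (i : 'I_n) (y : 'rV[R]_n) : R :=
  a * (u (b *: y) * partial i u (a *: y)) -
  b * (u (a *: y) * partial i u (b *: y)).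

Definition dflux (i : 'I_n) (y : 'rV[R]_n) : R :=
  y ord0 i * flux i y + (sqn y - 1) / 2 *
  (a ^+ 2 * (u (b *: y) * partial i (partial i u) (a *: y)) -
   b ^+ 2 * (u (a *: y) * partial i (partial i u) (b *: y))).

Lemma continuous_bilinear (f g : 'rV[R]_n -> R) (c d : R) y :
  (forall x, eball r3 x -> {for x, continuous f}) ->
  (forall x, eball r3 x -> {for x, continuous g}) -> sqn y <= 1 ->
  {for y, continuous (fun z : 'rV[R]_n =>
    c * (f (b *: z) * g (a *: z)) - d * (f (a *: z) * g (b *: z)))}.
Proof.
move=> cf cg y1.
have cfa := continuous_dilation cf a0 ar y1.
have cfb := continuous_dilation cf b0 br y1.
have cga := continuous_dilation cg a0 ar y1.
have cgb := continuous_dilation cg b0 br y1.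
exact: (continuousB (continuousM (cvg_cst c) (continuousM cfb cga))
  (continuousM (cvg_cst d) (continuousM cfa cgb))).
Qed.

Lemma continuous_flux i y : sqn y <= 1 -> {for y, continuous (flux i)}.
Proof.
apply: continuous_bilinear => x; first exact: harmonic_continuous.
exact: harmonic_partial_continuous.
Qed.

Lemma continuous_dflux i y : sqn y <= 1 -> {for y, continuous (dflux i)}.
Proof.
move=> y1.
have c2 := @continuous_bilinear u (partial i (partial i u)) (a ^+ 2) (b ^+ 2) y
  harmonic_continuous (@harmonic_partial2_continuous i) y1.
have cq : {for y, continuous (fun z : 'rV[R]_n => (sqn z - 1) / 2)}.
  have cs : {for y, continuous (@sqn R n)} by exact: continuous_sqn.
  have c1 (c : R) : {for y, continuous (cst c : 'rV[R]_n -> R)}.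
    exact: cst_continuous.
  exact: (continuousM (continuousB cs (c1 1)) (c1 2^-1)).
have cy : {for y, continuous (fun z : 'rV[R]_n => z ord0 i)}.
  exact: coord_continuous.
have cyf := continuousM cy (@continuous_flux i y y1).
exact: (continuousD cyf (continuousM cq c2)).
Qed.

(** The derivative of the weight is the coordinate [y_i]. In the derivative of [flux i] the two
    mixed products of first partials, both with coefficient ab, cancel; only pure second partials
    remain. *)
Lemma is_derive_dflux i (y : 'rV[R]_n) t : sqn (upd y i t) <= 1 ->
  is_derive t 1 (fun s => (sqn (upd y i s) - 1) / 2 * flux i (upd y i s))
    (dflux i (upd y i t)).
Proof.
move=> y1.
have [dua dpa _ _] := hu (eball_dilation a0 ar y1).
have [dub dpb _ _] := hu (eball_dilation b0 br y1).
have := is_derive_line dua; have := is_derive_line dub.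
have := is_derive_line (dpa i); have := is_derive_line (dpb i).
set Pb := fun s => partial i u _; set Pa := fun s => partial i u _.
set Ub := fun s => u _; set Ua := fun s => u _.
move=> dPb dPa dUb dUa.
have dq : is_derive t 1 (fun s => (sqn (upd y i s) - 1) / 2) t.
  rewrite (_ : (fun _ => _) = 2^-1 \*: (id ^+ 2 + cst (sqn (upd y i 0) - 1))).
    apply: is_derive_eq.
    by rewrite addr0 /GRing.scale/= mulr1 expr1 mulrA mulVf// mul1r.
  by apply/funext => s; rewrite sqn_upd !fctE/= mulrC addrA.
rewrite (_ : (fun s => _ * flux i _) = (fun s => (sqn (upd y i s) - 1) / 2) *
  (a \*: (Ub * Pa) - b \*: (Ua * Pb))) //.
apply: is_derive_eq.
rewrite /dflux /flux /Ua /Ub /Pa /Pb !fctE/= mxE eqxx.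
move: (u _) (u _) (partial _ _ _) (partial _ _ _) (partial _ _ _)
  (partial _ _ _) => p1 p2 p3 p4 p5 p6.
by rewrite /GRing.scale/= /GRing.scale/=; ring.
Qed.

(** The line meets the ball in an open chord or not at all. At the ends of the chord |y| = 1, so the
    primitive from [is_derive_dflux] vanishes at both. *)
Lemma line_integral_dflux i (y : 'rV[R]_n) :
  let S := [set t | eball 1 (upd y i t)] in
  [/\ measurable S, leb.-integrable S (fun t => (dflux i (upd y i t))%:E) &
      \int[leb]_(t in S) (dflux i (upd y i t))%:E = 0]%E.
Proof.
have SE t : eball 1 (upd y i t) <-> t ^+ 2 < 1 - sqn (upd y i 0).
  by rewrite /eball/= -[\sum_(_ < _) _]/(sqn _) sqn_upd expr1n ltrBrDr.
have [c1|c1] := leP 1 (sqn (upd y i 0)).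
  rewrite (_ : mkset _ = set0); last first.
    apply/seteqP; split=> // t /SE; apply/negP; rewrite -leNgt.
    by rewrite (le_trans _ (sqr_ge0 t))// subr_le0.
  by split; [exact: measurable0|exact: integrable_set0|rewrite integral_set0].
(* Half the length of the chord. *)
set rho := Num.sqrt (1 - sqn (upd y i 0)).
have rho0 : 0 < rho by rewrite sqrtr_gt0 subr_gt0.
have rho2 : rho ^+ 2 = 1 - sqn (upd y i 0) by rewrite sqr_sqrtr// subr_ge0 ltW.
rewrite (_ : mkset _ = `]-rho, rho[%classic); last first.
  apply/seteqP; split=> t /=; rewrite in_itv/= -ltr_norml -(@ltr_pXn2r _ 2)//
    ?nnegrE// ?(ltW rho0)// real_normK ?num_real// rho2; exact: (SE t).1 || exact: (SE t).2.
have le1 t : t \in `[-rho, rho] -> sqn (upd y i t) <= 1.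
  rewrite in_itv/= -ler_norml -(@ler_pXn2r _ 2)// ?nnegrE// ?(ltW rho0)//.
  by rewrite real_normK ?num_real// rho2 (sqn_upd y i t) lerBrDr.
have cf : {within `[-rho, rho], continuous (fun t => dflux i (upd y i t))}.
  apply: continuous_in_subspaceT => t /set_mem /= /le1 t1.
  apply: (@continuous_comp R 'rV[R]_n R (upd y i) (dflux i) t); last exact: continuous_dflux.
  apply: differentiable_continuous; apply/derivable1_diffP.
  have := is_derive_upd y i t 1.
  rewrite (_ : (fun s => _) = upd y i); first by move=> ?; exact: ex_derive.
  by apply/funext => s; rewrite scale1r.
have ic : leb.-integrable `[-rho, rho] (fun t => (dflux i (upd y i t))%:E).
  by apply: continuous_compact_integrable => //; exact: segment_compact.
have io : leb.-integrable `]-rho, rho[ (fun t => (dflux i (upd y i t))%:E).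
  by apply: integrableS ic => //; exact: subset_itv_oo_cc.
split=> //.
rewrite -(@integral_itv_bndoo R (-rho) rho _ true false); last exact: measurable_int io.
have cg t : t \in `[-rho, rho] -> {for t, continuous
    (fun s => (sqn (upd y i s) - 1) / 2 * flux i (upd y i s))}.
  move=> /le1 t1; apply: differentiable_continuous; apply/derivable1_diffP.
  exact: (@ex_derive _ _ _ _ _ _ _ (is_derive_dflux t1)).
rewrite (@continuous_FTC2 R _ (fun s => (sqn (upd y i s) - 1) / 2 * flux i (upd y i s))) //.
- rewrite (sqn_upd y i rho) (sqn_upd y i (- rho)) sqrrN rho2.
  by rewrite subrK subrr !mul0r subee.
- by rewrite gtrN.
- split.
  + move=> t /subset_itv_oo_cc /le1 t1.
    exact: (@ex_derive _ _ _ _ _ _ _ (is_derive_dflux t1)).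
  + apply: cvg_at_right_filter; apply: cg.
    by rewrite in_itv/= lexx ge0_cp// ltW.
  + apply: cvg_at_left_filter; apply: cg.
    by rewrite in_itv/= lexx andbT ge0_cp// ltW.
- move=> t /subset_itv_oo_cc /le1 t1.
  by rewrite derive1E; exact: (@derive_val _ _ _ _ _ _ _ (is_derive_dflux t1)).
Qed.

Lemma integral_dflux i : (\int[nu]_(y in B) (dflux i y)%:E = 0)%E.
Proof.
apply: (integral_zero_lines iint_nu (i := i)).
  by apply: (integrable_unit_ball iint_nu) => x; exact: continuous_dflux.
exact: line_integral_dflux.
Qed.

(** This is y . grad u evaluated at cy; multiplied by [c] it is the Euler operator y . grad applied
    to the dilate u(c y). *)
Definition euler (c : R) (y : 'rV[R]_n) : R :=
  \sum_(i < n) y ord0 i * partial i u (c *: y).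

(** When [dflux i] is summed over [i], the second partials assemble into Laplacians of [u] at ay and
    by, which vanish; what remains is y . X. *)
Lemma euler_symmetric : (\int[nu]_(y in B)
  (a * (u (b *: y) * euler a y) - b * (u (a *: y) * euler b y))%:E = 0)%E.
Proof.
transitivity (\int[nu]_(y in B) (\sum_(i < n) (dflux i y)%:E))%E.
  apply: eq_integral => y /set_mem yB.
  have y1 : sqn y <= 1 by rewrite -[leRHS](expr1n _ 2); exact: ltW.
  have [_ _ _ La] := hu (eball_dilation a0 ar y1).
  have [_ _ _ Lb] := hu (eball_dilation b0 br y1).
  have S1 : \sum_(i < n) y ord0 i * flux i y =
      a * (u (b *: y) * euler a y) - b * (u (a *: y) * euler b y).
    rewrite /euler !mulr_sumr -sumrB; apply: eq_bigr => i _.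
    by rewrite /flux; ring.
  have S2 : \sum_(i < n) (sqn y - 1) / 2 *
      (a ^+ 2 * (u (b *: y) * partial i (partial i u) (a *: y)) -
       b ^+ 2 * (u (a *: y) * partial i (partial i u) (b *: y))) =
      (sqn y - 1) / 2 * (a ^+ 2 * (u (b *: y) * laplacian u (a *: y)) -
       b ^+ 2 * (u (a *: y) * laplacian u (b *: y))).
    by rewrite /laplacian !mulr_sumr -sumrB mulr_sumr.
  by rewrite sumEFin /dflux big_split/= S1 S2 La Lb !mulr0 subrr mulr0 addr0.
rewrite integral_sum; first by rewrite big1// => i _; exact: integral_dflux.
- exact: measurable_unit_ball.
- by move=> i; apply: (integrable_unit_ball iint_nu) => x; exact: continuous_dflux.
Qed.
End euler_symmetry.

(** * Integrals of products of two dilates *)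

Section dilated_products.
Context {R : realType} (n : nat).
Variable nu : {measure set (borel R n) -> \bar R}.
Hypothesis iint_nu : forall f : 'rV[R]_n -> \bar R, (forall x, 0 <= f x)%E ->
  measurable_fun setT (f : borel R n -> \bar R) -> iint f = (\int[nu]_x f x)%E.
Local Notation B := (@eball R n 1 : set (borel R n)).
Variables (r3 : R) (u : 'rV[R]_n -> R).
Hypothesis hu : harmonic_on (@eball R n r3) u.

Lemma integrable_dilated_product a b : 0 <= a -> a < r3 -> 0 <= b -> b < r3 ->
  nu.-integrable B (EFin \o (fun y => u (a *: y) * u (b *: y))).
Proof.
move=> a0 ar b0 br; apply: (integrable_unit_ball iint_nu) => x x1.
have ca := continuous_dilation (harmonic_continuous hu) a0 ar x1.
have cb := continuous_dilation (harmonic_continuous hu) b0 br x1.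
exact: (continuousM ca cb).
Qed.

Lemma continuous_euler c y : 0 <= c -> c < r3 -> sqn y <= 1 ->
  {for y, continuous (euler u c)}.
Proof.
move=> c0 c3 y1; apply: continuous_bigsum => i.
have cp := continuous_dilation (harmonic_partial_continuous hu (i := i)) c0 c3 y1.
have cy : {for y, continuous (fun z : 'rV[R]_n => z ord0 i)}.
  exact: coord_continuous.
exact: (continuousM cy cp).
Qed.

(** All points cy lie in the closed ball of radius [rho] < [r3], which is compact. The bound is
    uniform in [c], as needed for a dominating function. *)
Lemma harmonic_bounds (rho : R) : 0 <= rho -> rho < r3 ->
  exists2 M : R, 0 < M & forall c y, 0 <= c <= rho -> sqn y <= 1 ->
    `|u (c *: y)| <= M /\ `|euler u c y| <= M.
Proof.
move=> rho0 rho3; pose K := [set x : 'rV[R]_n | sqn x <= rho ^+ 2].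
have K3 x : K x -> eball r3 x.
  move=> Kx; apply: le_lt_trans Kx _.
  by rewrite ltr_pXn2r// ?nnegrE// (le_trans rho0)// ltW.
have cK : compact K by exact: compact_sqn_le.
have [|M0 M00 uM0] := @continuous_bounded_on R n u K cK.
  by move=> x /K3; exact: harmonic_continuous hu x.
have /choice[M MP] i : exists M : R, 0 < M /\ forall x, K x -> `|partial i u x| <= M.
  have [|M M1 uM1] := @continuous_bounded_on R n (partial i u) K cK.
    by move=> x /K3; exact: harmonic_partial_continuous hu i x.
  by exists M.
have M0' i : 0 <= M i by have [/ltW] := MP i.
have SM0 : 0 <= \sum_i M i by exact: sumr_ge0.
exists (M0 + \sum_i M i); first by rewrite ltr_wpDr.
move=> c y /andP[c0 cr] y1.
have Kcy : K (c *: y).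
  rewrite /K/= sqnZ; apply: (@le_trans _ _ (c ^+ 2)).
    by rewrite ler_piMr// sqr_ge0.
  by rewrite ler_pXn2r// nnegrE.
split; first by rewrite (le_trans (uM0 _ Kcy))// lerDl.
apply: (@le_trans _ _ (\sum_i M i)); last by rewrite lerDr ltW.
rewrite /euler (le_trans (ler_norm_sum _ _ _))//; apply: ler_sum => i _.
have [_ uMi] := MP i.
rewrite normrM -[leRHS]mul1r ler_pM//; last exact: uMi.
by apply: coord_norm_le => //; rewrite expr1n.
Qed.

(** Differentiation under the integral sign along two arbitrary curves of radii. It serves twice:
    with x and st/x for the constancy in x, and with x and x for the continuity of [mean_sq]. *)
Lemma is_derive_integral_product (al be dal dbe : R -> R) (l h rho D : R) :
  0 <= rho -> rho < r3 ->
  (forall x, x \in `]l, h[ ->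
    [/\ is_derive x 1 al (dal x), is_derive x 1 be (dbe x),
        0 <= al x <= rho, 0 <= be x <= rho & `|dal x| <= D /\ `|dbe x| <= D]) ->
  forall a, a \in `]l, h[ ->
  is_derive a 1 (fun x => \int[nu]_(y in B) (u (al x *: y) * u (be x *: y)))
    (\int[nu]_(y in B) (dal a * (u (be a *: y) * euler u (al a) y) +
                        dbe a * (u (al a *: y) * euler u (be a) y))).
Proof.
move=> rho0 rho3 hI a aI.
have mB : measurable B by exact: measurable_unit_ball.
have [M M0 MP] := harmonic_bounds rho0 rho3.
have B1 (y : 'rV[R]_n) : B y -> sqn y <= 1.
  by move=> yB; rewrite -[leRHS](expr1n _ 2); exact: ltW.
have dP x (y : 'rV[R]_n) : x \in `]l, h[ -> B y ->
    is_derive x 1 (fun x => u (al x *: y) * u (be x *: y))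
      (dal x * (u (be x *: y) * euler u (al x) y) +
       dbe x * (u (al x *: y) * euler u (be x) y)).
  move=> xI /B1 y1; have [dax dbx /andP[ax0 ax] /andP[bx0 bx] _] := hI x xI.
  have [dua _ _ _] := hu (eball_dilation ax0 (le_lt_trans ax rho3) y1).
  have [dub _ _ _] := hu (eball_dilation bx0 (le_lt_trans bx rho3) y1).
  have d1 := is_derive_dilation dax dua; have d2 := is_derive_dilation dbx dub.
  apply: is_derive_eq (is_deriveM d1 d2) _.
  by rewrite /euler /GRing.scale/=; ring.
have d1E x (y : 'rV[R]_n) : x \in `]l, h[ -> B y ->
    partial1of2 (fun x (y : 'rV[R]_n) => u (al x *: y) * u (be x *: y)) x y =
      (dal x * (u (be x *: y) * euler u (al x) y) +
       dbe x * (u (al x *: y) * euler u (be x) y)).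
  by move=> xI yB; rewrite partial1of2E; exact: (@derive_val _ _ _ _ _ _ _ (dP x y xI yB)).
have D0 : 0 <= D by have [_ _ _ _ [+ _]] := hI a aI; exact: le_trans.
pose G := fun _ : borel R n => D * (M * M) + D * (M * M).
have G0 y : 0 <= G y by rewrite addr_ge0// mulr_ge0// mulr_ge0// ltW.
have intf x : `]l, h[%classic x -> nu.-integrable B
    (EFin \o (fun y : 'rV[R]_n => u (al x *: y) * u (be x *: y))).
  move=> xI; have [_ _ /andP[ax0 ax] /andP[bx0 bx] _] := hI x xI.
  by apply: integrable_dilated_product => //; exact: le_lt_trans rho3.
have derf x (y : 'rV[R]_n) : `]l, h[%classic x -> B y ->
    derivable (fun x => u (al x *: y) * u (be x *: y)) x 1.
  by move=> xI yB; exact: (@ex_derive _ _ _ _ _ _ _ (dP x y xI yB)).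
have intG : nu.-integrable B (EFin \o G).
  by apply: (integrable_unit_ball iint_nu) => x _; exact: cst_continuous.
have Gub x (y : 'rV[R]_n) : `]l, h[%classic x -> B y ->
    `|partial1of2 (fun x (y : 'rV[R]_n) => u (al x *: y) * u (be x *: y)) x y| <= G y.
  move=> xI yB; rewrite d1E// (le_trans (ler_normD _ _))//.
  have [_ _ ax bx [Da Db]] := hI x xI.
  have [ua ea] := MP _ _ ax (B1 _ yB); have [ub eb] := MP _ _ bx (B1 _ yB).
  rewrite /G !normrM; apply: lerD; apply: ler_pM => //; exact: ler_pM.
apply: DeriveDef.
  exact: (derivable_under_integral mB aI intf derf G0 intG Gub).
rewrite -derive1E (differentiation_under_integral mB aI intf derf G0 intG Gub).
by apply: eq_Rintegral => y /set_mem yB; rewrite d1E.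
Qed.

(** With J(x) the integral of u(xy) u((st/x) y), x = s gives the right side and x = m, where st/m =
    m, gives the left side; J has derivative zero by [euler_symmetric]. *)
Lemma dilated_product_constant (s t m : R) : 0 < s -> s < r3 -> 0 < t ->
  t < r3 -> 0 < m -> m ^+ 2 = s * t ->
  \int[nu]_(y in B) (u (m *: y) * u (m *: y)) =
  \int[nu]_(y in B) (u (s *: y) * u (t *: y)).
Proof.
move=> s0 s3 t0 t3 m0 mst.
pose M := Num.max s t.
have sM : s <= M by rewrite le_max lexx.
have tM : t <= M by rewrite le_max lexx orbT.
have M3 : M < r3 by rewrite gt_max s3.
(* On the open interval from st/rho to rho both x and st/x stay below rho, and that interval
   contains s and m. *)
have [rho Mrho rho3] : exists2 rho, M < rho & rho < r3.
  by exists ((M + r3) / 2); rewrite ?midf_lt.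
have rho0 : 0 < rho by rewrite (lt_trans _ Mrho)// (lt_le_trans s0).
have srho := le_lt_trans sM Mrho; have trho := le_lt_trans tM Mrho.
have p0 : 0 < s * t by rewrite mulr_gt0.
have mM : m <= M.
  have M0 : 0 < M by exact: lt_le_trans sM.
  rewrite -(@ler_pXn2r _ 2) ?nnegrE// ?(ltW m0) ?(ltW M0)//.
  by rewrite mst [leRHS]expr2 ler_pM ?(ltW s0) ?(ltW t0).
pose be x := s * t / x; pose dbe x : R := - (s * t) / x ^+ 2.
pose J x := \int[nu]_(y in B) (u (x *: y) * u (be x *: y)).
have lx x : x \in `]s * t / rho, rho[ -> [/\ 0 < x, s * t / rho < x & x < rho].
  rewrite in_itv/= => /andP[x1 x2]; split=> //.
  by apply: lt_trans x1; rewrite divr_gt0.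
have dJ x : x \in `]s * t / rho, rho[ -> is_derive x 1 J 0.
  move=> xI.
  have hI z : z \in `]s * t / rho, rho[ ->
      [/\ is_derive z 1 (@id R) ((cst 1 : R -> R) z), is_derive z 1 be (dbe z),
          0 <= id z <= rho, 0 <= be z <= rho &
          (* The term 1 bounds the derivative of x; the other bounds st/x^2, because x > st/rho. *)
          `|(cst 1 : R -> R) z| <= 1 + rho ^+ 2 / (s * t) /\
          `|dbe z| <= 1 + rho ^+ 2 / (s * t)].
    move=> /lx[z0 z1 z2]; split.
    - exact: is_derive_id.
    - have zn0 : z != 0 by rewrite gt_eqF.
      have dV : is_derive z 1 (fun x : R => x^-1) (- z ^- 2).
        have := @is_deriveV R (@id R) z 1 1 zn0 (is_derive_id _ _).
        by move=> h; apply: is_derive_eq h _; rewrite /GRing.scale/= mulr1.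
      have -> : be = (s * t) \*: (fun x : R => x^-1) by [].
      by apply: is_derive_eq; rewrite /dbe /GRing.scale/= mulrN mulNr.
    - by rewrite (ltW z0) ltW.
    - rewrite /be divr_ge0 ?(ltW p0) ?(ltW z0)//= ler_pdivrMr//.
      by rewrite [leRHS]mulrC -ler_pdivrMr// ltW.
    - split; first by rewrite normr1 lerDl divr_ge0 ?sqr_ge0// ltW.
      rewrite /dbe normrM normrN normfV (gtr0_norm p0) gtr0_norm ?exprn_gt0//.
      rewrite (@le_trans _ _ (rho ^+ 2 / (s * t)))// ?lerDr//.
      rewrite ler_pdivrMr ?exprn_gt0// mulrAC ler_pdivlMr// -!expr2 -exprMn.
      rewrite ler_pXn2r ?nnegrE ?mulr_ge0 ?(ltW rho0) ?(ltW z0) ?(ltW s0) ?(ltW t0)//.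
      by rewrite [leRHS]mulrC -ler_pdivrMr// ltW.
  have := is_derive_integral_product (ltW rho0) rho3 hI xI.
  move=> h; apply: is_derive_eq h _.
  have [_ _ /andP[x0 xr] /andP[b0 br] _] := hI x xI.
  have xp : 0 < x by have [] := lx x xI.
  (* The derivative of st/x is -(st/x)/x, so 1/x factors out and leaves the integrand of
     [euler_symmetric]. *)
  rewrite (_ : (fun y => _) = (fun y => x^-1 * (x * (u (be x *: y) * euler u x y)
     - be x * (u (x *: y) * euler u (be x) y)))).
    rewrite RintegralZl//.
    - rewrite /Rintegral (euler_symmetric iint_nu hu x0 (le_lt_trans xr rho3) b0
        (le_lt_trans br rho3)).
      by rewrite mulr0.
    - exact: measurable_unit_ball.
    - apply: (integrable_unit_ball iint_nu) => z z1.
      have xr3 := le_lt_trans xr rho3; have br3 := le_lt_trans br rho3.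
      have ca := continuous_dilation (harmonic_continuous hu) x0 xr3 z1.
      have cb := continuous_dilation (harmonic_continuous hu) b0 br3 z1.
      have ea := continuous_euler x0 xr3 z1.
      have eb := continuous_euler b0 br3 z1.
      exact: (continuousB (continuousM (cvg_cst x) (continuousM cb ea))
        (continuousM (cvg_cst (be x)) (continuousM ca eb))).
  by apply/funext => y /=; rewrite /dbe /be; field; rewrite gt_eqF.
have JI x y : s * t / rho < x -> x <= y -> y < rho -> J x = J y.
  move=> x1 xy y2.
  have xyI z : z \in `[x, y] -> z \in `]s * t / rho, rho[.
    by rewrite !in_itv/= => /andP[xz zy]; rewrite (lt_le_trans x1)//= (le_lt_trans zy).
  have hd z : z \in `]x, y[ -> is_derive z 1 J ((cst 0 : R -> R) z).
    by move=> /subset_itv_oo_cc /xyI; exact: dJ.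
  have cJ : {within `[x, y], continuous J}.
    apply: derivable_within_continuous => z /xyI /dJ h.
    exact: (@ex_derive _ _ _ _ _ _ _ h).
  have [z _ Jz] := MVT_segment xy hd cJ.
  have {}Jz : J y - J x = 0 by rewrite Jz mul0r.
  by apply/esym/eqP; rewrite -subr_eq0 Jz.
have JI2 x y : s * t / rho < x -> x < rho -> s * t / rho < y -> y < rho -> J x = J y.
  move=> x1 x2 y1 y2; have [xy|/ltW yx] := leP x y; first exact: JI.
  by apply/esym; exact: JI.
have Js : J s = \int[nu]_(y in B) (u (s *: y) * u (t *: y)).
  by rewrite /J /be mulrAC divff ?mul1r// gt_eqF.
have Jm : J m = \int[nu]_(y in B) (u (m *: y) * u (m *: y)).
  by rewrite /J /be -mst expr2 mulfK// gt_eqF.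
rewrite -Js -Jm; apply: JI2.
- rewrite ltr_pdivrMr// -mst expr2 ltr_pM2l//; exact: le_lt_trans Mrho.
- exact: le_lt_trans Mrho.
- by rewrite ltr_pdivrMr// ltr_pM2l.
- exact: srho.
Qed.
End dilated_products.

(** * Log-convexity *)

Section midpoint_convexity.
Context {R : realType}.

(* Adding the strictly convex perturbation d * (x - a)^2 forces the maximum to
   be attained at an end point. *)
Lemma midpoint_convex_max (f : R -> R) (a b M : R) : a <= b ->
  {within `[a, b], continuous f} ->
  (forall x y, x \in `[a, b] -> y \in `[a, b] ->
    f ((x + y) / 2) <= (f x + f y) / 2) ->
  f a <= M -> f b <= M -> forall x, x \in `[a, b] -> f x <= M.
Proof.
move=> ab cf mf fa fb x xab; rewrite leNgt; apply/negP => fx.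
pose D := (b - a) ^+ 2 + 1.
have D0 : 0 < D by rewrite ltr_wpDl// sqr_ge0.
(* Small enough that the perturbation at [b] stays below f x - M, so no end point can be the maximum
   of [g]. The 1 added in [D] keeps it positive when a = b. *)
pose d := (f x - M) / (2 * D).
have d0 : 0 < d by rewrite divr_gt0 ?mulr_gt0// subr_gt0.
pose g z := f z + d * (z - a) ^+ 2.
have cg : {within `[a, b], continuous g}.
  move=> z; apply: cvgD; first exact: cf.
  have ci : {within `[a, b], continuous (fun z : R => d * (z - a) ^+ 2)}.
    apply: continuous_subspaceT => t.
    apply: differentiable_continuous; exact: ex_diff.
  exact: ci.
have [c cab gmax] := EVT_max ab cg.
have gxc := gmax x xab.
have fgx : f x <= g x by rewrite lerDl mulr_ge0 ?sqr_ge0// ltW.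
have db : d * (b - a) ^+ 2 < f x - M.
  apply: (@lt_le_trans _ _ (d * (2 * D))); last by rewrite /d divfK// gt_eqF ?mulr_gt0.
  rewrite ltr_pM2l// /D; have := sqr_ge0 (b - a); lra.
move: (cab); rewrite in_itv/= => /andP[ac cb].
have [ca|ca] := eqVneq c a.
  move: gxc; rewrite ca {2}/g subrr expr0n mulr0 addr0; lra.
have [cb'|cb'] := eqVneq c b.
  move: gxc; rewrite cb' {2}/g; lra.
have {}ac : a < c by rewrite lt_neqAle eq_sym ca.
have {}cb : c < b by rewrite lt_neqAle cb'.
(* At an interior maximum [c], the points c - h and c + h lie in the interval. Midpoint convexity of
   [f] and the quadratic term give g c <= g c - d h^2. *)
pose h := Num.min (c - a) (b - c).
have h0 : 0 < h by rewrite lt_min !subr_gt0 ac.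
have h1 : h <= c - a by rewrite ge_min lexx.
have h2 : h <= b - c by rewrite ge_min lexx orbT.
have m1 : c - h \in `[a, b] by rewrite in_itv/=; apply/andP; split; lra.
have m2 : c + h \in `[a, b] by rewrite in_itv/=; apply/andP; split; lra.
have := mf _ _ m1 m2; rewrite (_ : (c - h + (c + h)) / 2 = c); last by field.
have := gmax _ m1; have := gmax _ m2; rewrite /g.
have : 0 < d * h ^+ 2 by rewrite mulr_gt0 ?exprn_gt0.
have -> : (c + h - a) ^+ 2 = (c - a) ^+ 2 + 2 * (c - a) * h + h ^+ 2 by ring.
have -> : (c - h - a) ^+ 2 = (c - a) ^+ 2 - 2 * (c - a) * h + h ^+ 2 by ring.
rewrite !mulrDr mulrN; lra.
Qed.

(** The value c = sqrt(y/x) minimises the right side and turns it into 2 sqrt(xy). The hypothesis is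
    the linear form of Cauchy-Schwarz, which can be integrated pointwise. *)
Lemma geometric_mean_le (g x y : R) : 0 <= g -> 0 < x -> 0 < y ->
  (forall c, 0 < c -> 2 * g <= c * x + c^-1 * y) -> g ^+ 2 <= x * y.
Proof.
move=> g0 x0 y0 h.
have sqrtP z : 0 < z -> exists2 a : R, 0 < a & z = a ^+ 2.
  by move=> z0; exists (Num.sqrt z); rewrite ?sqrtr_gt0// sqr_sqrtr// ltW.
have [a a0 xE] := sqrtP x x0; have [b b0 yE] := sqrtP y y0.
have /h : 0 < b / a by rewrite divr_gt0.
have -> : b / a * x + (b / a)^-1 * y = 2 * (a * b).
  by rewrite xE yE; field; rewrite !gt_eqF.
rewrite ler_pM2l// => gab; rewrite xE yE -exprMn ler_pXn2r// nnegrE//.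
by rewrite mulr_ge0// ltW.
Qed.

(** In the variable t = log r, the difference of log H and its chord is continuous, midpoint convex
    and zero at both ends, hence nonpositive between them. *)
Lemma log_convex_three_points (H : R -> R) (r1 r2 r3 : R) :
  0 < r1 -> r1 < r2 -> r2 < r3 ->
  (forall x, r1 <= x <= r3 -> 0 < H x /\ {for x, continuous H}) ->
  (forall s t m, r1 <= s <= r3 -> r1 <= t <= r3 -> 0 < m -> m ^+ 2 = s * t ->
    H m ^+ 2 <= H s * H t) ->
  (ln r3 - ln r1) * ln (H r2) <=
    (ln r3 - ln r2) * ln (H r1) + (ln r2 - ln r1) * ln (H r3).
Proof.
move=> r10 r12 r23 HP HM.
have r20 := lt_trans r10 r12; have r30 := lt_trans r20 r23.
set t1 := ln r1; set t2 := ln r2; set t3 := ln r3.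
have t12 : t1 < t2 by rewrite ltr_ln ?posrE.
have t23 : t2 < t3 by rewrite ltr_ln ?posrE.
have e1 : expR t1 = r1 by rewrite lnK ?posrE.
have e2 : expR t2 = r2 by rewrite lnK ?posrE.
have e3 : expR t3 = r3 by rewrite lnK ?posrE.
have eI t : t \in `[t1, t3] -> r1 <= expR t <= r3.
  by rewrite in_itv/= -{1}e1 -{1}e3 !ler_expR.
pose A := ln (H r1); pose C := ln (H r3).
(* The difference to the chord, multiplied by t3 - t1 so that no quotient appears. *)
pose f t := (t3 - t1) * ln (H (expR t)) - ((t3 - t) * A + (t - t1) * C).
suff : f t2 <= 0 by rewrite /f e2 subr_le0.
have t13 := lt_trans t12 t23.
apply: (@midpoint_convex_max f t1 t3) => //.
- exact: ltW.
- apply: continuous_in_subspaceT => t /set_mem /= /eI tI.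
  have [H0 cH] := HP _ tI.
  have c1 : {for t, continuous (H \o expR)}.
    by apply: continuous_comp => //; exact: continuous_expR.
  have c2 : {for t, continuous (@ln R \o (H \o expR))}.
    by apply: continuous_comp => //; exact: continuous_ln.
  have c3 : {for t, continuous (fun s : R => (t3 - s) * A + (s - t1) * C)}.
    by apply: differentiable_continuous; exact: ex_diff.
  have c0 : {for t, continuous (cst (t3 - t1) : R -> R)} by exact: cst_continuous.
  exact: (continuousB (continuousM c0 c2) c3).
- move=> x y xI yI.
  have [Hx _] := HP _ (eI _ xI); have [Hy _] := HP _ (eI _ yI).
  have mI : (x + y) / 2 \in `[t1, t3].
    by move: xI yI; rewrite !in_itv/= => /andP[? ?] /andP[? ?]; apply/andP; split; lra.
  have [Hm _] := HP _ (eI _ mI).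
  have := HM _ _ (expR ((x + y) / 2)) (eI _ xI) (eI _ yI) (expR_gt0 _).
  rewrite -expRD expr2 -expRD -splitr => /(_ erefl).
  rewrite -ler_ln ?posrE ?exprn_gt0 ?mulr_gt0// lnM ?posrE// expr2 lnM ?posrE//.
  rewrite /f; set p := ln (H (expR x)); set q := ln (H (expR y)).
  set m := ln (H _) => pq.
  have : (t3 - t1) * (m + m) <= (t3 - t1) * (p + q) by rewrite ler_pM2l ?subr_gt0.
  rewrite !mulrDr; lra.
- by rewrite /f e1 subrr mul0r addr0 subrr.
- by rewrite /f e3 subrr mul0r add0r subrr.
- by rewrite in_itv/= (ltW t12) ltW.
Qed.
End midpoint_convexity.

(** * Log-convexity of the square integral of a harmonic function *)

Section three_balls.
Context {R : realType} (n : nat).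
Variables (r3 : R) (u : 'rV[R]_n -> R).
Hypothesis hu : harmonic_on (@eball R n r3) u.

Section dilated_squares.
Variable nu : {measure set (borel R n) -> \bar R}.
Hypothesis iint_nu : forall f : 'rV[R]_n -> \bar R, (forall x, 0 <= f x)%E ->
  measurable_fun setT (f : borel R n -> \bar R) -> iint f = (\int[nu]_x f x)%E.
Local Notation B := (@eball R n 1 : set (borel R n)).

(** The function G of the overview, not divided by the volume of B; written as a product to match
    [dilated_product_constant]. *)
Definition mean_sq (r : R) : R := \int[nu]_(y in B) (u (r *: y) * u (r *: y)).

Lemma mean_sq_ge0 r : 0 <= mean_sq r.
Proof. by apply: Rintegral_ge0 => y _; rewrite -expr2 sqr_ge0. Qed.

Lemma continuous_mean_sq a : 0 < a -> a < r3 -> {for a, continuous mean_sq}.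
Proof.
move=> a0 a3; pose rho := (a + r3) / 2.
have arho : a < rho by rewrite midf_lt.
have rho3 : rho < r3 by rewrite midf_lt.
have rho0 : 0 <= rho by rewrite ltW// (lt_trans a0).
have hI x : x \in `]0, rho[ ->
    [/\ is_derive x 1 (@id R) ((cst 1 : R -> R) x),
        is_derive x 1 (@id R) ((cst 1 : R -> R) x), 0 <= id x <= rho,
        0 <= id x <= rho &
        `|(cst 1 : R -> R) x| <= 1 /\ `|(cst 1 : R -> R) x| <= 1].
  by rewrite in_itv/= => /andP[/ltW x0 /ltW x1];
    split; rewrite ?x0 ?normr1//; exact: is_derive_id.
have aI : a \in `]0, rho[ by rewrite in_itv/= a0.
have := is_derive_integral_product iint_nu hu rho0 rho3 hI aI => h.
apply: differentiable_continuous; apply/derivable1_diffP.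
exact: (@ex_derive _ _ _ _ _ _ _ h).
Qed.

(** With v = u(sy) and w = u(ty), the pointwise bound 2vw <= c v^2 + w^2/c is integrated; the
    integral of vw is G(m). *)
Lemma mean_sq_geometric s t m c : 0 < s -> s < r3 -> 0 < t -> t < r3 -> 0 < m ->
  m ^+ 2 = s * t -> 0 < c ->
  2 * mean_sq m <= c * mean_sq s + c^-1 * mean_sq t.
Proof.
move=> s0 s3 t0 t3 m0 mst c0.
have mB : measurable B by exact: measurable_unit_ball.
have iP a b : 0 < a -> a < r3 -> 0 < b -> b < r3 ->
    nu.-integrable B (EFin \o (fun y => u (a *: y) * u (b *: y))).
  move=> a0 a3 b0 b3.
  exact: (integrable_dilated_product iint_nu hu (ltW a0) a3 (ltW b0) b3).
have iZ (k : R) (f : 'rV[R]_n -> R) : nu.-integrable B (EFin \o f) ->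
    nu.-integrable B (EFin \o (fun y => k * f y)).
  by move=> h; exact: (integrableZl mB k h).
rewrite /mean_sq (dilated_product_constant iint_nu hu s0 s3 t0 t3 m0 mst).
rewrite -RintegralZl//; last exact: iP.
rewrite -RintegralZl//; last exact: iP.
rewrite -[X in _ <= _ + X]RintegralZl//; last exact: iP.
rewrite -RintegralD//; last 2 first.
- by apply: iZ; exact: iP.
- by apply: iZ; exact: iP.
apply: le_Rintegral => //.
- by apply: iZ; exact: iP.
- have h := integrableD mB (iZ c _ (iP s s s0 s3 s0 s3)) (iZ c^-1 _ (iP t t t0 t3 t0 t3)).
  exact: h.
move=> y _; move: (u (s *: y)) (u (t *: y)) => v w.
have : 0 <= c^-1 * (c * v - w) ^+ 2 by rewrite mulr_ge0 ?sqr_ge0// invr_ge0 ltW.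
rewrite (_ : _ * _ ^+ 2 = c * (v * v) + c^-1 * (w * w) - 2 * (v * w)) ?subr_ge0//.
by field; rewrite gt_eqF.
Qed.

Lemma mean_sq_log_convex e r1 r2 r : 0 <= e -> 0 < r1 -> r1 < r2 -> r2 < r ->
  r < r3 -> (forall x, r1 <= x <= r -> 0 < mean_sq x + e) ->
  (ln r - ln r1) * ln (mean_sq r2 + e) <=
  (ln r - ln r2) * ln (mean_sq r1 + e) + (ln r2 - ln r1) * ln (mean_sq r + e).
Proof.
move=> e0 r10 r12 r2r rr3 pos.
apply: (@log_convex_three_points R (fun x => mean_sq x + e)) => //.
  move=> x xI; split; first exact: pos.
  have /andP[x1 x2] := xI.
  have cm := continuous_mean_sq (lt_le_trans r10 x1) (le_lt_trans x2 rr3).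
  have ce : {for x, continuous (cst e : R -> R)} by exact: cst_continuous.
  exact: (continuousD cm ce).
move=> s t m sI tI m0 mst; have /andP[s1 s2] := sI; have /andP[t1 t2] := tI.
have s0 := lt_le_trans r10 s1; have t0 := lt_le_trans r10 t1.
apply: geometric_mean_le; [|exact: pos|exact: pos|].
  by rewrite addr_ge0// mean_sq_ge0.
move=> c c0.
have := mean_sq_geometric s0 (le_lt_trans s2 rr3) t0 (le_lt_trans t2 rr3) m0 mst c0.
have : 0 <= e * (c^-1 * (c - 1) ^+ 2).
  by rewrite mulr_ge0// mulr_ge0 ?sqr_ge0// invr_ge0 ltW.
rewrite (_ : e * _ = c * e + c^-1 * e - 2 * e); last by field; rewrite gt_eqF.
rewrite !mulrDr; lra.
Qed.

(** If G(r2) were positive, log-convexity of G + e would bound log e from below as e tends to 0,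
    since log(G(r1) + e) = log e. *)
Lemma mean_sq_vanish r1 r2 : 0 < r1 -> r1 < r2 -> r2 < r3 ->
  mean_sq r1 = 0 -> mean_sq r2 = 0.
Proof.
move=> r10 r12 r23 G1; apply/eqP; rewrite eq_le mean_sq_ge0 andbT leNgt.
apply/negP => G2; pose r := (r2 + r3) / 2.
have r2r : r2 < r by rewrite midf_lt.
have rr3 : r < r3 by rewrite midf_lt.
have r20 := lt_trans r10 r12; have r0 := lt_trans r20 r2r.
have l12 : ln r1 < ln r2 by rewrite ltr_ln ?posrE.
have l2r : ln r2 < ln r by rewrite ltr_ln ?posrE.
pose K := `|(ln r - ln r1) * ln (mean_sq r2) -
  (ln r2 - ln r1) * ln (mean_sq r + 1)| + 1.
have K1 : (ln r - ln r1) * ln (mean_sq r2) -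
  (ln r2 - ln r1) * ln (mean_sq r + 1) > - K.
  rewrite /K ltrNl; set z := _ - _.
  by rewrite (le_lt_trans (ler_norm (- z)))// normrN ltrDl.
(* Chosen so that (ln r - ln r2) ln e = -K, below the bound [K1]; also e <= 1, so G(r) + e may be
   replaced by G(r) + 1. *)
pose e := expR (- (K / (ln r - ln r2))).
have d0 : 0 < ln r - ln r2 by rewrite subr_gt0.
have K0 : 0 <= K by rewrite addr_ge0.
have e0 : 0 < e by exact: expR_gt0.
have e1 : e <= 1 by rewrite /e -expR0 ler_expR oppr_le0 divr_ge0// ltW.
have := @mean_sq_log_convex e r1 r2 r (ltW e0) r10 r12 r2r rr3 _.
have pos x : r1 <= x <= r -> 0 < mean_sq x + e.
  by move=> _; rewrite ltr_wpDl// mean_sq_ge0.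
move=> /(_ pos); rewrite G1 add0r {2}/e expRK mulrN mulrCA divff ?gt_eqF// mulr1.
have : (ln r - ln r1) * ln (mean_sq r2) <= (ln r - ln r1) * ln (mean_sq r2 + e).
  rewrite ler_pM2l ?subr_gt0 ?(lt_trans l12)// ler_ln ?posrE ?addr_gt0//.
  by rewrite lerDl ltW.
have : (ln r2 - ln r1) * ln (mean_sq r + e) <= (ln r2 - ln r1) * ln (mean_sq r + 1).
  rewrite ler_pM2l ?subr_gt0// ler_ln ?posrE ?lerD2l//.
    by rewrite ltr_wpDl// mean_sq_ge0.
  by rewrite ltr_wpDl// mean_sq_ge0.
lra.
Qed.

Local Notation I r := (iint (fun x => (\1_(eball r) x * u x ^+ 2)%:E)).

Lemma iint_mean_sq r : 0 < r -> r < r3 -> I r = (r ^+ n * mean_sq r)%:E.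
Proof.
move=> r0 rr3; rewrite (iint_ball_dilation iint_nu)//; last first.
  move=> x xr; apply: harmonic_continuous hu _ _; apply: lt_trans xr _.
  by rewrite ltr_pXn2r// nnegrE// ltW// (lt_trans r0).
rewrite EFinM; congr (_ * _)%E; rewrite /mean_sq /Rintegral fineK//.
by apply: integrable_fin_num;
  [exact: measurable_unit_ball|
   exact: (integrable_dilated_product iint_nu hu (ltW r0) rr3 (ltW r0) rr3)].
Qed.

(** Stated in the extended reals because r' = r3 is included, where the integral may be infinite. *)
Lemma le_iint_ball r r' : 0 < r -> r <= r' -> r' <= r3 -> (I r <= I r')%E.
Proof.
move=> r0 rr' r'3.
have sub s : 0 < s -> s <= r3 -> @eball R n s `<=` eball r3.
  move=> s0 s3 x xs; apply: lt_le_trans xs _.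
  by rewrite ler_pXn2r// nnegrE ltW// (lt_le_trans s0).
have f0 s x : (0 <= (\1_(@eball R n s) x * u x ^+ 2)%:E)%E.
  by rewrite lee_fin mulr_ge0// sqr_ge0.
have mI s : 0 < s -> s <= r3 -> measurable_fun setT
    ((fun x => (\1_(eball s) x * u x ^+ 2)%:E) : borel R n -> \bar R).
  move=> s0 s3; apply: measurable_indic_sqr; first exact: open_eball.
  by move=> x /(sub s s0 s3); exact: harmonic_continuous hu x.
have r'0 := lt_le_trans r0 rr'; have r3' := le_trans rr' r'3.
rewrite !iint_nu; try exact: f0; try exact: mI.
apply: ge0_le_integral => //; try exact: mI.
move=> x _; rewrite lee_fin ler_wpM2r ?sqr_ge0// !indicE ler_nat.
have [/set_mem xr|//] := boolP (x \in _); rewrite mem_set//.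
by apply: lt_le_trans xr _; rewrite ler_pXn2r// nnegrE ltW.
Qed.

(** For r < r3 the terms n ln r cancel from the convexity inequality, and the integral at r is at
    most [F3]. With [F3] in place, r enters only through the coefficients and can tend to r3. *)
Lemma iint_log_convex r1 r2 (F1 F2 F3 : R) : 0 < r1 -> r1 < r2 -> r2 < r3 ->
  I r1 = F1%:E -> I r2 = F2%:E -> I r3 = F3%:E -> 0 < F1 ->
  (ln r3 - ln r1) * ln F2 <=
  (ln r3 - ln r2) * ln F1 + (ln r2 - ln r1) * ln F3.
Proof.
move=> r10 r12 r23 I1 I2 I3 F10.
have r20 := lt_trans r10 r12; have r30 := lt_trans r20 r23.
have F13 : 0 < F3.
  rewrite (lt_le_trans F10)// -lee_fin -I1 -I3 le_iint_ball// ltW//.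
  exact: lt_trans r23.
have l12 : ln r1 < ln r2 by rewrite ltr_ln ?posrE.
have l23 : ln r2 < ln r3 by rewrite ltr_ln ?posrE.
have step r : r2 < r -> r < r3 ->
    (ln r - ln r1) * ln F2 <= (ln r - ln r2) * ln F1 + (ln r2 - ln r1) * ln F3.
  move=> r2r rr3; have r0 := lt_trans r20 r2r.
  have G0 x : r1 <= x <= r -> 0 < mean_sq x.
    move=> /andP[r1x xr]; have x0 := lt_le_trans r10 r1x.
    have x3 := le_lt_trans xr rr3.
    have : (0 < I x)%E.
      by apply: lt_le_trans (le_iint_ball r10 r1x (ltW x3)); rewrite I1 lte_fin.
    by rewrite iint_mean_sq// lte_fin pmulr_rgt0// exprn_gt0.
  have FE x : r1 <= x <= r -> ln (fine (I x)) = n%:R * ln x + ln (mean_sq x).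
    move=> xI; have /andP[r1x xr] := xI; have x0 := lt_le_trans r10 r1x.
    rewrite iint_mean_sq//; last exact: le_lt_trans rr3.
    by rewrite lnM ?posrE ?exprn_gt0// ?G0//= lnXn// mulr_natl.
  have m1 : r1 <= r1 <= r by rewrite lexx ltW// (lt_trans r12).
  have m2 : r1 <= r2 <= r by rewrite !ltW.
  have m3 : r1 <= r <= r by rewrite lexx ltW// (lt_trans r12).
  have FF3 : ln (fine (I r)) <= ln F3.
    have Fr : 0 < fine (I r).
      by rewrite iint_mean_sq//= mulr_gt0 ?exprn_gt0// G0.
    rewrite ler_ln ?posrE// -lee_fin -I3 fineK; first by rewrite le_iint_ball// ltW.
    by rewrite iint_mean_sq.
  have pos x : r1 <= x <= r -> 0 < mean_sq x + 0 by rewrite addr0; exact: G0.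
  have := mean_sq_log_convex (lexx 0) r10 r12 r2r rr3 pos; rewrite !addr0.
  have := FE _ m1; have := FE _ m2; move: FF3; rewrite (FE _ m3) I1 I2 /=.
  move=> FF3 -> ->.
  have : (ln r2 - ln r1) * (n%:R * ln r + ln (mean_sq r)) <=
      (ln r2 - ln r1) * ln F3 by rewrite ler_pM2l ?subr_gt0.
  rewrite -subr_ge0 => h1; rewrite -subr_ge0 => h2; rewrite -subr_ge0.
  by have := addr_ge0 h1 h2; congr (0 <= _); ring.
pose q := (ln r3 - ln r1) * ln F2 -
  ((ln r3 - ln r2) * ln F1 + (ln r2 - ln r1) * ln F3).
rewrite -subr_le0 -/q leNgt; apply/negP => q0.
(* The limit made quantitative: if the inequality failed by [q], applying [step] at ln r = ln r3 - d
   would give q <= d (ln F2 - ln F1) <= d w <= q/2. The first term of the minimum keeps r above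
   r2. *)
pose w := `|ln F2 - ln F1| + 1.
have w0 : 0 < w by rewrite ltr_wpDl.
pose d := Num.min ((ln r3 - ln r2) / 2) (q / (2 * w)).
have d0 : 0 < d by rewrite lt_min !divr_gt0 ?mulr_gt0// subr_gt0.
have d1 : d <= (ln r3 - ln r2) / 2 by rewrite ge_min lexx.
have d2 : d * w <= q / 2.
  by rewrite -ler_pdivlMr// -mulrA -invfM ge_min lexx orbT.
have := step (expR (ln r3 - d)); rewrite expRK.
have r2e : r2 < expR (ln r3 - d).
  by rewrite -{1}(lnK (x := r2)) ?posrE// ltr_expR; lra.
have er3 : expR (ln r3 - d) < r3.
  by rewrite -{2}(lnK (x := r3)) ?posrE// ltr_expR; lra.
move=> /(_ r2e er3) h3.
have dw : d * (ln F2 - ln F1) <= d * w.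
  by rewrite ler_pM2l// /w (le_trans (ler_norm _))// lerDl.
have qd : q <= d * (ln F2 - ln F1).
  move: h3; rewrite -subr_ge0 -[in X in _ -> X]subr_ge0 /q.
  by congr (0 <= _); ring.
by have := le_trans qd (le_trans dw d2); lra.
Qed.

End dilated_squares.
End three_balls.

(** * The three ball inequality *)

Section three_ball_inequality.
Context {R : realType}.

Lemma interpolation_exponent (r1 r2 r3 : R) : 0 < r1 -> r1 < r2 -> r2 < r3 ->
  0 < (ln r3 - ln r2) / (ln r3 - ln r1) < 1.
Proof.
move=> r10 r12 r23; have r20 := lt_trans r10 r12; have r30 := lt_trans r20 r23.
have l12 : ln r1 < ln r2 by rewrite ltr_ln ?posrE.
have l23 : ln r2 < ln r3 by rewrite ltr_ln ?posrE.
have l13 : 0 < ln r3 - ln r1 by rewrite subr_gt0 (lt_trans l12).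
rewrite divr_gt0 ?subr_gt0 ?(lt_trans l12)//= ltr_pdivrMr// mul1r.
by rewrite ltrD2l ltrN2.
Qed.

Lemma powR_log_interpolation (x y z a : R) : 0 < x -> 0 < y -> 0 < z ->
  ln y <= a * ln x + (1 - a) * ln z ->
  y `^ 2^-1 <= (x `^ 2^-1) `^ a * (z `^ 2^-1) `^ (1 - a).
Proof.
move=> x0 y0 z0 h.
rewrite -ler_ln ?posrE ?mulr_gt0 ?powR_gt0// lnM ?posrE ?powR_gt0// !ln_powR.
by rewrite mulrCA [X in _ + X]mulrCA -mulrDr ler_pM2l.
Qed.

Lemma three_ball_inequality n (r1 r2 r3 : R) (u : 'rV[R]_n -> R)
    (alpha := (ln r3 - ln r2) / (ln r3 - ln r1)) :
  0 < r1 -> r1 < r2 -> r2 < r3 -> harmonic_on (@eball R n r3) u ->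
  (L2ball r2 u <=
     poweR (L2ball r1 u) alpha * poweR (L2ball r3 u) (1 - alpha))%E.
Proof.
move=> r10 r12 r23 hu.
have /andP[al0 al1] : 0 < alpha < 1 by exact: interpolation_exponent.
have [nu iint_nu] := @iint_measure R n.
have r20 := lt_trans r10 r12; have r30 := lt_trans r20 r23.
have r13 := lt_trans r12 r23.
have I1 := iint_mean_sq hu iint_nu r10 r13.
have I2 := iint_mean_sq hu iint_nu r20 r23.
have I3ge := le_iint_ball hu iint_nu r10 (ltW r13) (lexx r3).
set G1 := mean_sq u nu r1 in I1; set G2 := mean_sq u nu r2 in I2.
have [G10|G1neq0] := eqVneq G1 0.
  have G20 : G2 = 0 by exact: (mean_sq_vanish hu iint_nu r10 r12 r23 G10).
  rewrite {1}/L2ball I2 G20 mulr0 poweR_EFin powR0 ?invr_eq0//.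
  by rewrite mule_ge0// poweR_ge0.
have G1gt0 : 0 < G1 by rewrite lt_neqAle eq_sym G1neq0 mean_sq_ge0.
set F1 := r1 ^+ n * G1 in I1; set F2 := r2 ^+ n * G2 in I2.
have F10 : 0 < F1 by rewrite mulr_gt0// exprn_gt0.
have F20 : 0 < F2.
  rewrite -lte_fin -I2; apply: lt_le_trans (le_iint_ball hu iint_nu r10 (ltW r12) (ltW r23)).
  by rewrite I1 lte_fin.
rewrite /L2ball I1 I2 !poweR_EFin.
case I3 : (iint _) => [F3| |]; last first.
- by move: I3ge; rewrite I3 I1.
(* Infinite norm on the largest ball: 1 - alpha is nonzero and the other factor is positive, so the
   right side is infinite. *)
- rewrite /= invr_eq0 pnatr_eq0/= subr_eq0 gt_eqF//.
  by rewrite gt0_muley ?leey// lte_fin !powR_gt0.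
have F30 : 0 < F3 by rewrite -lte_fin -I3 (lt_le_trans _ I3ge)// I1 lte_fin.
rewrite !poweR_EFin -EFinM lee_fin.
apply: powR_log_interpolation => //.
have := iint_log_convex hu iint_nu r10 r12 r23 I1 I2 I3 F10.
have l13 : 0 < ln r3 - ln r1 by rewrite subr_gt0 ltr_ln ?posrE.
(* After division by ln r3 - ln r1 the two weights are alpha and 1 - alpha. *)
rewrite mulrC -ler_pdivlMr// => /le_trans; apply; rewrite le_eqVlt.
by apply/orP; left; apply/eqP; rewrite /alpha; field; rewrite gt_eqF.
Qed.
End three_ball_inequality.

(** * Optimality *)

Section harmonic_powers.
Context {R : realType} (n : nat).
Implicit Types (x v : 'rV[R]_n.+2).

Let i0 : 'I_n.+2 := ord0.
Let i1 : 'I_n.+2 := lift ord0 ord0.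

(* The real and imaginary parts of (x_0 + i x_1)^k. *)
Fixpoint zpow (k : nat) (x : 'rV[R]_n.+2) : R * R :=
  if k is k'.+1 then
    (x ord0 i0 * (zpow k' x).1 - x ord0 i1 * (zpow k' x).2,
     x ord0 i0 * (zpow k' x).2 + x ord0 i1 * (zpow k' x).1)
  else (1, 0).

Definition zre k x := (zpow k x).1.
Definition zim k x := (zpow k x).2.

Lemma zreS k : zre k.+1 = fun x => x ord0 i0 * zre k x - x ord0 i1 * zim k x.
Proof. by []. Qed.

Lemma zimS k : zim k.+1 = fun x => x ord0 i0 * zim k x + x ord0 i1 * zre k x.
Proof. by []. Qed.

Lemma differentiable_coord_rV i x :
  differentiable (fun x : 'rV[R]_n.+2 => x ord0 i : R) x.
Proof. exact: differentiable_coord. Qed.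

Lemma is_derive_coord_rV i x v :
  is_derive x v (fun x : 'rV[R]_n.+2 => x ord0 i : R) (v ord0 i).
Proof.
apply: DeriveDef; first by apply: diff_derivable; exact: differentiable_coord_rV.
rewrite /derive; apply: cvg_lim => //; apply: cvg_near_cst; near=> h.
rewrite /= !mxE addrK /GRing.scale/= mulKf//.
by near: h; exact: nbhs_dnbhs_neq.
Unshelve. all: by end_near. Qed.

Lemma differentiable_zpow k x :
  differentiable (zre k) x /\ differentiable (zim k) x.
Proof.
elim: k => [|k [dre dim]]; first by split; exact: differentiable_cst.
split.
  apply: (@differentiableB _ _ _ (fun x => x ord0 i0 * zre k x)
    (fun x => x ord0 i1 * zim k x));
  apply: (@differentiableM _ _ (fun x : 'rV[R]_n.+2 => x ord0 _ : R)) => //;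
  exact: differentiable_coord_rV.
apply: (@differentiableD _ _ _ (fun x => x ord0 i0 * zim k x)
    (fun x => x ord0 i1 * zre k x));
  apply: (@differentiableM _ _ (fun x : 'rV[R]_n.+2 => x ord0 _ : R)) => //;
  exact: differentiable_coord_rV.
Qed.

(** Real and imaginary parts of the derivative k z^(k-1) (v_0 + i v_1) of z^k. At k = 0 the factor k
    removes the meaningless z^(k-1). *)
Lemma is_derive_zpow k x v :
  is_derive x v (zre k)
    (k%:R * (v ord0 i0 * zre k.-1 x - v ord0 i1 * zim k.-1 x)) /\
  is_derive x v (zim k)
    (k%:R * (v ord0 i0 * zim k.-1 x + v ord0 i1 * zre k.-1 x)).
Proof.
elim: k => [|k [dre dim]].
  by rewrite !mul0r; split; exact: is_derive_cst.
have d0 := is_derive_coord_rV i0 x v; have d1 := is_derive_coord_rV i1 x v.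
split.
  have h := is_deriveB (is_deriveM d0 dre) (is_deriveM d1 dim).
  apply: is_derive_eq h _; rewrite /GRing.scale/=.
  case: k {dre dim} => [|k]; first by rewrite /zre /zim/=; ring.
  by rewrite /= (zreS k) (zimS k) [k.+2%:R]mulrS; ring.
have h := is_deriveD (is_deriveM d0 dim) (is_deriveM d1 dre).
apply: is_derive_eq h _; rewrite /GRing.scale/=.
case: k {dre dim} => [|k]; first by rewrite /zre /zim/=; ring.
by rewrite /= (zreS k) (zimS k) [k.+2%:R]mulrS; ring.
Qed.

Lemma partial_zre k i : partial i (zre k) = fun x => k%:R *
  ((delta_mx ord0 i : 'rV[R]_n.+2) ord0 i0 * zre k.-1 x -
   (delta_mx ord0 i : 'rV[R]_n.+2) ord0 i1 * zim k.-1 x).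
Proof.
apply/funext => x; rewrite /partial.
by have [h _] := is_derive_zpow k x (delta_mx ord0 i); rewrite derive_val.
Qed.

Lemma is_derive_zcomb k (a b : R) x v :
  is_derive x v (fun x => k%:R * (a * zre k.-1 x - b * zim k.-1 x))
  (k%:R * (k.-1%:R *
     (a * (v ord0 i0 * zre k.-2 x - v ord0 i1 * zim k.-2 x) -
      b * (v ord0 i0 * zim k.-2 x + v ord0 i1 * zre k.-2 x)))).
Proof.
have [dre dim] := is_derive_zpow k.-1 x v.
have h := is_deriveZ (k%:R) (is_deriveB (is_deriveZ a dre) (is_deriveZ b dim)).
by apply: is_derive_eq h _; rewrite /GRing.scale/=; ring.
Qed.

Lemma differentiable_zcomb (a b c : R) k x :
  differentiable (fun x => c * (a * zre k x - b * zim k x)) x.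
Proof.
have [dre dim] := differentiable_zpow k x.
exact: (differentiableZ c (differentiableB (differentiableZ a dre)
  (differentiableZ b dim))).
Qed.

(** The second partial in directions i, j is the real part of k (k-1) e_i e_j z^(k-2), where e_0 is
    1, e_1 the imaginary unit and the other e_i are 0. The Laplacian vanishes because the squares of
    the e_i sum to 0. *)
Lemma harmonic_zre k (A : set 'rV[R]_n.+2) : harmonic_on A (zre k).
Proof.
move=> x _.
have p2 i j : partial j (partial i (zre k)) = fun x => k%:R * (k.-1%:R *
     ((delta_mx ord0 i : 'rV[R]_n.+2) ord0 i0 *
      ((delta_mx ord0 j : 'rV[R]_n.+2) ord0 i0 * zre k.-2 x -
       (delta_mx ord0 j : 'rV[R]_n.+2) ord0 i1 * zim k.-2 x) -
      (delta_mx ord0 i : 'rV[R]_n.+2) ord0 i1 *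
      ((delta_mx ord0 j : 'rV[R]_n.+2) ord0 i0 * zim k.-2 x +
       (delta_mx ord0 j : 'rV[R]_n.+2) ord0 i1 * zre k.-2 x))).
  rewrite partial_zre; apply/funext => y; rewrite {1}/partial.
  have h := is_derive_zcomb k ((delta_mx ord0 i : 'rV[R]_n.+2) ord0 i0)
    ((delta_mx ord0 i : 'rV[R]_n.+2) ord0 i1) y (delta_mx ord0 j).
  by rewrite derive_val.
split.
- by have [] := differentiable_zpow k x.
- by move=> i; rewrite partial_zre; exact: differentiable_zcomb.
- move=> i j; apply: differentiable_continuous; rewrite p2.
  set a := (delta_mx ord0 i : 'rV[R]_n.+2) ord0 i0.
  set b := (delta_mx ord0 i : 'rV[R]_n.+2) ord0 i1.
  set c := (delta_mx ord0 j : 'rV[R]_n.+2) ord0 i0.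
  set d := (delta_mx ord0 j : 'rV[R]_n.+2) ord0 i1.
  rewrite (_ : (fun x => _) = fun x => (k%:R * k.-1%:R) *
    ((a * c - b * d) * zre k.-2 x - (a * d + b * c) * zim k.-2 x)).
    exact: differentiable_zcomb.
  by apply/funext => y; ring.
- rewrite /laplacian !big_ord_recl !p2 big1 => [|i _].
    by rewrite !mxE/=; ring.
  by rewrite p2 !mxE/=; ring.
Qed.

Lemma zpow_dilation k r x :
  zre k (r *: x) = r ^+ k * zre k x /\ zim k (r *: x) = r ^+ k * zim k x.
Proof.
elim: k => [|k [re im]]; first by rewrite /zre /zim/= expr0 mulr0 mul1r.
by rewrite zreS zimS /= !mxE re im exprS; split; ring.
Qed.

Lemma zre_axis k (c : R) :
  zre k (c *: delta_mx ord0 i0) = c ^+ k /\ zim k (c *: delta_mx ord0 i0) = 0.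
Proof.
elim: k => [|k [re im]]; first by rewrite /zre /zim/= expr0.
by rewrite zreS zimS !mxE re im exprS/=; split; ring.
Qed.

Variable nu : {measure set (borel R n.+2) -> \bar R}.
Hypothesis iint_nu : forall f : 'rV[R]_n.+2 -> \bar R, (forall x, 0 <= f x)%E ->
  measurable_fun setT (f : borel R n.+2 -> \bar R) -> iint f = (\int[nu]_x f x)%E.
Local Notation B := (@eball R n.+2 1 : set (borel R n.+2)).

(** At the point x_0 = 1/2 of the first axis the function equals 2^-k. By continuity it exceeds half
    this value on a small box inside B, and the box has positive volume. *)
Lemma mean_sq_zre_gt0 k : 0 < mean_sq (zre k) nu 1.
Proof.
have cre x : {for x, continuous (zre k)}.
  by apply: differentiable_continuous; have [] := differentiable_zpow k x.
pose x0 : 'rV[R]_n.+2 := 2^-1 *: delta_mx ord0 i0.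
pose c := zre k x0.
have c0 : 0 < c by rewrite /c; have [-> _] := zre_axis k 2^-1; rewrite exprn_gt0.
have Bx0 : B x0.
  rewrite /eball/= -[\sum_(_ < _) _]/(sqn _) sqnZ /sqn big_ord_recl big1.
    by rewrite !mxE eqxx/= !expr1n addr0 mulr1 expr2; lra.
  by move=> i _; rewrite !mxE/= expr0n.
have [e e0 he] : exists2 e : R, 0 < e & box x0 e `<=` [set x | c / 2 < zre k x] `&` B.
  have : nbhs x0 ([set x | c / 2 < zre k x] `&` B).
    apply: filterI; last by apply: open_nbhs_nbhs; split => //; exact: open_eball.
    have nb : nbhs (zre k x0) [set z : R | c / 2 < z].
      apply: open_nbhs_nbhs; split; first exact: open_gt.
      by rewrite /= -/c ltr_pdivrMr// ltr_pMr// ltr1n.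
    exact: (cre x0 _ nb).
  move=> /nbhs_ballP[e /= e0 h]; exists e => // x xb; apply: h; split=> // i j.
  by rewrite ord1; exact: xb.
have mB : measurable B by exact: measurable_unit_ball.
have mbox : measurable (box x0 e : set (borel R n.+2)).
  by apply: measurable_open; exact: open_box.
have hz : harmonic_on (@eball R n.+2 2) (zre k) by exact: harmonic_zre.
have h12 : (1 : R) < 2 by rewrite ltr1n.
have int1 := integrable_dilated_product iint_nu hz ler01 h12 ler01 h12.
have fin1 := integrable_fin_num mB int1.
rewrite -lte_fin /mean_sq /Rintegral fineK//.
apply: (@lt_le_trans _ _ ((c / 2) ^+ 2 * (2 * e) ^+ n.+2)%:E).
  by rewrite lte_fin mulr_gt0// exprn_gt0// ?mulr_gt0// divr_gt0.
rewrite EFinM -(measure_box iint_nu x0 e0) -integral_cst//.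
apply: (@le_trans _ _ (\int[nu]_(y in box x0 e)
    (zre k (1 *: y) * zre k (1 *: y))%:E)%E); last first.
  apply: ge0_subset_integral => //.
  - exact: measurable_int int1.
  - by move=> x _; rewrite lee_fin -expr2 sqr_ge0.
  - by move=> x /he[].
apply: ge0_le_integral => //.
- by move=> x _; rewrite lee_fin sqr_ge0.
- apply: measurable_funS mB _ (measurable_int _ int1) => x /he[]//.
move=> x /he[/= cx _]; rewrite scale1r lee_fin -expr2 ler_pXn2r ?nnegrE ?ltW//.
- by rewrite divr_gt0.
- by apply: lt_trans cx; rewrite divr_gt0.
Qed.

(** Homogeneity of degree k contributes r^(2k) to the square integral, and the Jacobian r^(n+2). *)
Lemma L2ball_zre k (r : R) : 0 < r ->
  L2ball r (zre k) = ((r ^+ (n.+2 + k * 2) * mean_sq (zre k) nu 1) `^ 2^-1)%:E.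
Proof.
move=> r0; rewrite /L2ball.
(* The radius r + 2 exceeds both r and 1, the two radii at which [mean_sq] is used. *)
have hz : harmonic_on (@eball R n.+2 (r + 2)) (zre k) by exact: harmonic_zre.
have r2 : r < r + 2 by rewrite ltrDl.
rewrite (iint_mean_sq hz iint_nu r0 r2) poweR_EFin; congr (_ `^ _)%:E.
rewrite exprD -mulrA; congr (_ * _); rewrite /mean_sq.
have h12 : (1 : R) < r + 2 by lra.
have int1 := integrable_dilated_product iint_nu hz ler01 h12 ler01 h12.
rewrite -RintegralZl//; last exact: measurable_unit_ball.
apply: eq_Rintegral => y _; rewrite scale1r.
by have [-> _] := zpow_dilation k r y; rewrite exprM; ring.
Qed.
End harmonic_powers.

(** After taking logarithms the unknown constant G drops out, as the exponents talpha and 1 - talpha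
    sum to 1. There remains N d / 2 <= ln C with N >= 2k, which fails for large k. *)
Lemma exponent_optimal {R : realType} n (r1 r2 r3 talpha C : R) :
  0 < r1 -> r1 < r2 -> r2 < r3 ->
  (ln r3 - ln r2) / (ln r3 - ln r1) < talpha -> 0 < C ->
  (forall u : 'rV[R]_n.+2 -> R, harmonic_on setT u ->
    (L2ball r2 u <= C%:E * poweR (L2ball r1 u) talpha
                         * poweR (L2ball r3 u) (1 - talpha))%E) -> False.
Proof.
move=> r10 r12 r23 alt C0 H.
have r20 := lt_trans r10 r12; have r30 := lt_trans r20 r23.
have l13 : 0 < ln r3 - ln r1.
  by rewrite subr_gt0 ltr_ln ?posrE// (lt_trans r12).
have [nu iint_nu] := @iint_measure R n.+2.
(* Equal to (talpha - alpha) (ln r3 - ln r1), hence positive. *)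
pose d := ln r2 - talpha * ln r1 - (1 - talpha) * ln r3.
have d0 : 0 < d.
  move: alt; rewrite ltr_pdivrMr// -subr_gt0 /d.
  by congr (0 < _); ring.
have [k kd] : exists k : nat, ln C < k%:R * d.
  exists (Num.truncn (`|ln C| / d)).+1.
  rewrite -ltr_pdivrMr//; apply: le_lt_trans (Num.Theory.truncnS_gt _).
  by rewrite ler_pM2r ?invr_gt0// ler_norm.
have := H _ (@harmonic_zre R n k setT).
rewrite !(L2ball_zre iint_nu)//.
have G0 := mean_sq_zre_gt0 iint_nu k.
set G := mean_sq _ _ _ in G0 *.
have : 2 * k%:R <= (n.+2 + k * 2)%:R :> R.
  by rewrite natrD natrM mulrC lerDr.
move: (n.+2 + k * 2)%N => N kN.
have YP r : 0 < r -> exists2 y, (r ^+ N * G) `^ 2^-1 = y &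
    0 < y /\ ln y = 2^-1 * (N%:R * ln r + ln G).
  move=> r0; have X0 : 0 < r ^+ N * G by rewrite mulr_gt0// exprn_gt0.
  exists ((r ^+ N * G) `^ 2^-1) => //; split; first exact: powR_gt0.
  by rewrite ln_powR lnM ?posrE ?exprn_gt0// lnXn// mulr_natl.
have [y1 -> [y10 ly1]] := YP r1 r10.
have [y2 -> [y20 ly2]] := YP r2 r20.
have [y3 -> [y30 ly3]] := YP r3 r30.
rewrite !poweR_EFin -!EFinM lee_fin.
have z1 : 0 < y1 `^ talpha by exact: powR_gt0.
have z3 : 0 < y3 `^ (1 - talpha) by exact: powR_gt0.
have Cz1 : 0 < C * y1 `^ talpha by exact: mulr_gt0.
rewrite -ler_ln ?posrE//; last exact: mulr_gt0.
rewrite (lnM Cz1 z3) (lnM C0 z1) !ln_powR ly1 ly2 ly3.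
rewrite -subr_ge0 [leRHS](_ : _ = ln C - 2^-1 * (N%:R * d)); last first.
  by rewrite /d; field.
rewrite subr_ge0 => hN.
have : k%:R * d <= 2^-1 * (N%:R * d).
  by rewrite mulrA ler_pM2r// ler_pdivlMl.
by move=> h; have := lt_le_trans kd (le_trans h hN); rewrite ltxx.
Qed.

Unset Implicit Arguments.

Theorem theorem2p1 (R : realType) (n : nat) (hn : n = 2%N \/ n = 3%N)
    (r1 r2 r3 : R) (h1 : 0 < r1) (h12 : r1 < r2) (h23 : r2 < r3) :
  let alpha := (ln r3 - ln r2) / (ln r3 - ln r1) in
  [/\ 0 < alpha < 1,
      (forall u : 'rV[R]_n -> R, harmonic_on (@eball R n r3) u ->
         (L2ball r2 u <=
            poweR (L2ball r1 u) alpha * poweR (L2ball r3 u) (1 - alpha))%E)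
    & ~ (exists (talpha C : R), alpha < talpha /\ 0 < C /\
          forall u : 'rV[R]_n -> R, harmonic_on setT u ->
            (L2ball r2 u <=
               C%:E * poweR (L2ball r1 u) talpha
                    * poweR (L2ball r3 u) (1 - talpha))%E)].
Proof.
move=> alpha; split.
- exact: interpolation_exponent.
- by move=> u hu; exact: three_ball_inequality.
- move=> [talpha [C [alt [C0 H]]]].
  by case: hn => nE; rewrite nE in H; exact: (exponent_optimal h1 h12 h23 alt C0 H).
Qed.
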